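(* Let $n\in\mathbb{N}$, let $M$ be a spatially compact conical Minkowski spacetime in $\mathbb{L}^{n+1}$ with induced Lorentzian distance $d$, and let $\mathcal{C}_M$ be the set of Cauchy hypersurfaces of $M$. Then \[ d_J(S_1,S_2)=\sup_{u\in S_1,\,v\in S_2}\big(d(u,v)+d(v,u)\big),\qquad S_1,S_2\in\mathcal{C}_M, \] takes values in $[0,\infty)$ and defines a metric $d_J:\mathcal{C}_M\times\mathcal{C}_M\to[0,\infty)$ on $\mathcal{C}_M$.
   Context: $\mathbb{L}^{n+1}$ is $(n+1)$-dimensional Minkowski space with inner product $\langle\cdot,\cdot\rangle$ of signature $(-,+,\dots,+)$ and $|v|=\sqrt{|\langle v,v\rangle|}$. A vector $v$ is spacelike if $\langle v,v\rangle>0$, causal if it is not spacelike, timelike if $\langle v,v\rangle<0$. Fix a timelike vector $v_0$; a causal vector $v$ is future-directed if $\langle v,v_0\rangle<0$. $I^+(O)$ is the set of future-directed timelike vectors, $\mathbb{R}_+=(0,\infty)$, and $\mathbb{H}^n=\{v\in I^+(O):\langle v,v\rangle=-1\}$ is hyperbolic space with its induced Riemannian metric. A domain in $\mathbb{H}^n$ is a nonempty $n$-dimensional $C^{0,1}$-submanifold of $\mathbb{H}^n$ with boundary (not necessarily connected). A conical Minkowski spacetime is a cone $M=\mathbb{R}_+\Omega$ for a domain $\Omega\subset\mathbb{H}^n$. A causal (timelike) curve is a locally Lipschitz curve $\gamma$, defined on an interval, with $\gamma'(t)$ causal (timelike) for almost every $t$, and such that, after possibly reversing the parametrization, it is future-directed,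 i.e. $\langle\gamma'(t),v_0\rangle<0$ almost everywhere. A causal curve in $M$ is inextendible if none of its reparametrizations is the restriction of a causal curve in $M$ defined on a larger interval. A Cauchy hypersurface of $M$ is a subset of $M$ that is met exactly once by every inextendible timelike curve in $M$. $M$ is spatially compact if it has a Cauchy hypersurface and all its Cauchy hypersurfaces are compact; this is equivalent to the compactness of $\Omega$. For $u,v\in M$ write $u\le v$ if there is a future-directed causal curve in $M$ from $u$ to $v$. The Lorentzian distance $d(u,v)$ of $M$ is the supremum of the lengths $L(\gamma)=\int|\gamma'(t)|\,dt$ over all future-directed causal curves $\gamma$ from $u$ to $v$ contained in $M$ if $u\le v$, and $d(u,v)=0$ otherwise. *)

(* Defs.v *)
From HB Require Import structures.
From mathcomp Require Import all_boot all_order all_algebra.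
From mathcomp Require Import all_classical all_reals all_analysis.

Set Implicit Arguments.
Unset Strict Implicit.
Unset Printing Implicit Defensive.

Import Order.TTheory GRing.Theory Num.Theory.
Import numFieldNormedType.Exports.

Local Open Scope classical_set_scope.
Local Open Scope ring_scope.

Section Minkowski.
Context {R : realType} {n : nat}.
Local Notation L := 'rV[R]_n.+1.

(* Coordinate 0 is the time coordinate. *)
Definition mink (u v : L) : R :=
  - (u ord0 ord0 * v ord0 ord0)
  + \sum_(i < n) u ord0 (lift ord0 i) * v ord0 (lift ord0 i).

Definition mnorm (v : L) : R := Num.sqrt `|mink v v|.

Definition spacelike (v : L) : Prop := 0 < mink v v.
Definition causal (v : L) : Prop := ~ spacelike v.
Definition timelike (v : L) : Prop := mink v v < 0.

Section TimeOriented.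
Context (v0 : L).

Definition future_directed (v : L) : Prop := mink v v0 < 0.

Definition Iplus : set L := [set v | timelike v /\ future_directed v].

Definition hyperbolic_space : set L := [set v | Iplus v /\ mink v v = -1].

(* On compact parts of hyperbolic space the Riemannian distance and the ambient
   norm distance are bi-Lipschitz equivalent, so that local Lipschitz
   continuity (class C^{0,1}) may be expressed with the ambient norm. *)
Definition C01_chart (U : set L) (phi : L -> 'rV[R]_n) : Prop :=
  [/\ exists2 O : set L, open O & U = O `&` hyperbolic_space,
      open (phi @` U),
      [locally [lipschitz phi x | x in U]] &
      exists psi : 'rV[R]_n -> L,
        {in U, cancel phi psi} /\ [locally [lipschitz psi y | y in phi @` U]]].

(* An n-dimensional C^{0,1}-submanifold with boundary of hyperbolic space:
   around each of its points some chart of hyperbolic space carries Omega either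
   onto the whole chart image or onto its intersection with a half-space
   (only the first case can occur for n = 0). *)
Definition hyperbolic_domain (Omega : set L) : Prop :=
  [/\ Omega !=set0,
      Omega `<=` hyperbolic_space &
      forall p, Omega p -> exists (U : set L) (phi : L -> 'rV[R]_n),
        [/\ U p,
            C01_chart U phi &
            U `<=` Omega \/
            exists i : 'I_n,
              phi @` (U `&` Omega) =
              phi @` U `&` [set x : 'rV[R]_n | 0 <= x ord0 i]]].

Definition cone (Omega : set L) : set L :=
  [set v | exists r w, [/\ 0 < r, Omega w & v = r *: w]].

Definition conical_spacetime (M : set L) : Prop :=
  exists2 Omega, hyperbolic_domain Omega & M = cone Omega.

(* [gamma] is only meaningful on [I]; values outside [I] can affect the
   derivative at the endpoints of [I] only. *)
Definition future_curve (P : L -> Prop) (M : set L) (I : set R)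
    (gamma : R -> L) : Prop :=
  [/\ is_interval I /\ I° !=set0,
      gamma @` I `<=` M,
      [locally [lipschitz (gamma : R^o -> L) t | t in (I : set R^o)]] &
      {ae (@lebesgue_measure R), forall t, I t ->
        [/\ derivable (gamma : R^o -> L) t 1, P (derive1 gamma t) &
            future_directed (derive1 gamma t)]}].

Definition directed_curve (P : L -> Prop) (M : set L) (I : set R)
    (gamma : R -> L) : Prop :=
  future_curve P M I gamma \/
  future_curve P M (-%R @` I) (gamma \o -%R).

Definition causal_curve := directed_curve causal.
Definition timelike_curve := directed_curve timelike.

(* A strictly monotone bijection between intervals is a homeomorphism. *)
Definition reparametrization (I J : set R) (phi : R -> R) : Prop :=
  [/\ is_interval J,
      phi @` J = I &
      {in J &, {homo phi : s t / s < t}} \/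
      {in J &, {homo phi : s t / s < t >-> t < s}}].

Definition inextendible (M : set L) (I : set R) (gamma : R -> L) : Prop :=
  ~ exists (J K : set R) (phi : R -> R) (delta : R -> L),
      [/\ reparametrization I J phi,
          J `<` K,
          causal_curve M K delta &
          {in J, delta =1 gamma \o phi}].

Definition Cauchy_hypersurface (M : set L) : set (set L) :=
  [set S | S `<=` M /\
    forall (I : set R) (gamma : R -> L),
      timelike_curve M I gamma -> inextendible M I gamma ->
      exists! t, I t /\ S (gamma t)].

Definition spatially_compact (M : set L) : Prop :=
  Cauchy_hypersurface M !=set0 /\
  forall S, Cauchy_hypersurface M S -> compact S.

Definition future_causal_from_to (M : set L) (u v : L) (a b : R)
    (gamma : R -> L) : Prop :=
  [/\ future_curve causal M `[a, b] gamma, gamma a = u & gamma b = v].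

Definition causal_le (M : set L) (u v : L) : Prop :=
  exists a b gamma, future_causal_from_to M u v a b gamma.

Definition curve_length (a b : R) (gamma : R -> L) : \bar R :=
  (\int[@lebesgue_measure R]_(t in `[a, b]) (mnorm (derive1 gamma t))%:E)%E.

Definition lorentz_dist (M : set L) (u v : L) : \bar R :=
  if `[< causal_le M u v >] then
    ereal_sup [set l | exists a b gamma,
      future_causal_from_to M u v a b gamma /\ l = curve_length a b gamma]
  else 0%E.

Definition dJ (M : set L) (S1 S2 : set L) : \bar R :=
  ereal_sup [set (lorentz_dist M p.1 p.2 + lorentz_dist M p.2 p.1)%E
            | p in S1 `*` S2].

End TimeOriented.
End Minkowski.

Definition is_metric_on {R : realType} {X : Type} (C : set X)
    (d : X -> X -> R) : Prop :=
  [/\ forall x y, C x -> C y -> 0 <= d x y,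
      forall x y, C x -> C y -> (d x y = 0 <-> x = y),
      forall x y, C x -> C y -> d x y = d y x &
      forall x y z, C x -> C y -> C z -> d x z <= d x y + d y z].

(* Main.v *)
(** A curve in the cone stays in the cone when it is multiplied by a positive
    function. This gives both halves of the argument. First, the rays
    [t |-> exp t *: p] are inextendible timelike curves, so a Cauchy
    hypersurface meets every ray exactly once. Second, if a causal curve [gamma]
    from [u] to [v] had positive length, then [exp (phi t) *: gamma t], where
    [phi] vanishes at both ends, decreases a little where [gamma] is strictly
    timelike and increases elsewhere, would be a timelike curve from [u] to
    [v]; prolonged along the rays of [u] and [v] it is inextendible, so [u] and
    [v] cannot lie on one Cauchy hypersurface. Hence [dJ S S = 0].

    Finiteness follows from the reverse Cauchy-Schwarz inequality, which bounds
    the length of a curve by the increase of [- <gamma, v0>], and compactness.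

    For the triangle inequality take a causal curve from [u] in [S1] to [v] in
    [S3]. If [S2] passes above [v] or below [u] on their rays, prolong the curve
    along that ray until [S2]. Otherwise [S2] lies above the start and below
    the end of the curve, and since the set of parameters where [S2] lies above
    (resp. below) the curve is closed, by compactness of [S2], the curve
    crosses [S2] and can be split there. *)

Require Import Defs.
From mathcomp Require Import all_boot all_order all_algebra.
From mathcomp Require Import all_classical all_reals all_analysis.
From mathcomp Require Import measurable_realfun ring lra.
Set Implicit Arguments.
Unset Strict Implicit.
Unset Printing Implicit Defensive.
Import Order.TTheory GRing.Theory Num.Theory.
Import numFieldNormedType.Exports.
Local Open Scope classical_set_scope.
Local Open Scope ring_scope.

(** * Algebra and sign rules of the Minkowski inner product *)

Section MinkowskiAlgebra.
Context {R : realType} {n : nat}.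
Local Notation L := 'rV[R]_n.+1.
Implicit Types (x y z v w : L) (r s : R).

Lemma minkC x y : mink x y = mink y x.
Proof.
rewrite /mink mulrC; congr (_ + _).
by apply: eq_bigr => i _; rewrite mulrC.
Qed.

Lemma minkDl x y z : mink (x + y) z = mink x z + mink y z.
Proof.
rewrite /mink !mxE mulrDl opprD addrACA -big_split/=.
by congr (_ + _); apply: eq_bigr => i _; rewrite mxE mulrDl.
Qed.

Lemma minkZl r x y : mink (r *: x) y = r * mink x y.
Proof.
rewrite /mink !mxE mulrDr mulrN mulr_sumr -mulrA; congr (_ + _).
by apply: eq_bigr => i _; rewrite mxE mulrA.
Qed.

Lemma minkDr x y z : mink x (y + z) = mink x y + mink x z.
Proof. by rewrite minkC minkDl !(minkC _ x). Qed.

Lemma minkZr r x y : mink x (r *: y) = r * mink x y.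
Proof. by rewrite minkC minkZl minkC. Qed.

Lemma minkNl x y : mink (- x) y = - mink x y.
Proof. by rewrite -scaleN1r minkZl mulN1r. Qed.

Lemma mink0l y : mink 0 y = 0.
Proof. by rewrite -(scale0r 0) minkZl mul0r. Qed.

(** The sum of the squares of [D * f i - C * g i] equals [D * (A * D - C ^+ 2)]; one may divide by
    [D] unless every [g i] vanishes. *)
Lemma sum_cauchy_schwarz (I : finType) (f g : I -> R) :
  (\sum_i f i * g i) ^+ 2 <= (\sum_i f i ^+ 2) * (\sum_i g i ^+ 2).
Proof.
set A := \sum_i f i ^+ 2; set C := \sum_i f i * g i; set D := \sum_i g i ^+ 2.
have D0 : 0 <= D by apply: sumr_ge0 => i _; exact: sqr_ge0.
have : 0 <= \sum_i (D * f i - C * g i) ^+ 2.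
  by apply: sumr_ge0 => i _; exact: sqr_ge0.
have -> : \sum_i (D * f i - C * g i) ^+ 2 = D * (A * D - C ^+ 2).
  transitivity (\sum_i (D ^+ 2 * f i ^+ 2 + ((- 2 * D * C) * (f i * g i)
      + C ^+ 2 * g i ^+ 2))).
    by apply: eq_bigr => i _; ring.
  rewrite !big_split/= -!mulr_sumr -/A -/C -/D; ring.
move: D0; rewrite le_eqVlt => /orP[/eqP D0 _|D0].
  have -> : C = 0.
    apply: big1 => i _; have /eqP := esym D0.
    rewrite psumr_eq0; last by move=> j _; exact: sqr_ge0.
    by move=> /allP/(_ i (mem_index_enum i))/=; rewrite sqrf_eq0 => /eqP->; rewrite mulr0.
  by rewrite expr0n/= -D0 mulr0.
by rewrite pmulr_rge0// subr_ge0.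
Qed.

(** Adding back the product of the time coordinates leaves the Euclidean inner product of the
    spatial parts. *)
Let spatial_cauchy_schwarz x y :
  (mink x y + x ord0 ord0 * y ord0 ord0) ^+ 2 <=
  (mink x x + x ord0 ord0 ^+ 2) * (mink y y + y ord0 ord0 ^+ 2).
Proof.
rewrite /mink -!expr2 ![- _ + _]addrC !subrK.
apply: le_trans (sum_cauchy_schwarz _ _) _.
by under eq_bigr do rewrite expr2; under [X in _ * X]eq_bigr do rewrite expr2.
Qed.

Let spatial_ge0 x : 0 <= mink x x + x ord0 ord0 ^+ 2.
Proof.
rewrite /mink -expr2 addrC addrA subrr add0r.
by apply: sumr_ge0 => i _; rewrite -expr2 sqr_ge0.
Qed.

(** If [x] has nonzero time coordinate, the product of the spatial parts is strictly smaller in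
    absolute value than that of the time coordinates, so the latter decides the sign. *)
Lemma mink_lt0 x y : timelike y -> causal x ->
  (mink x y < 0) = (0 < x ord0 ord0 * y ord0 ord0).
Proof.
rewrite /timelike /causal /spacelike => ty /negP; rewrite -leNgt => cx.
have := spatial_cauchy_schwarz x y.
have := spatial_ge0 x; have := spatial_ge0 y.
move: (mink x x) (mink y y) (mink x y) (x _ _) (y _ _) ty cx => a b c p q.
move=> b0 a0 bq ap h.
(* A causal vector with vanishing time coordinate has no spatial part either, and both sides are
   false. *)
have [p0|p0] := eqVneq p 0.
  rewrite p0 mul0r ltxx; apply/negbTE; rewrite -leNgt.
  have a0' : a = 0 by rewrite p0 expr0n addr0 in ap; lra.
  rewrite a0' p0 expr0n/= !mul0r !addr0 mul0r in h.
  have : c ^+ 2 = 0 by apply/eqP; rewrite eq_le h sqr_ge0.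
  by move=> /eqP; rewrite sqrf_eq0 => /eqP->.
have p2 : 0 < p ^+ 2 by rewrite exprn_even_gt0//= p0 orbT.
have {}h : (c + p * q) ^+ 2 < (p * q) ^+ 2.
  apply: le_lt_trans h _; rewrite exprMn.
  have : (a + p ^+ 2) * (b + q ^+ 2) <= p ^+ 2 * (b + q ^+ 2) by apply: ler_wpM2r => //; lra.
  by move/le_lt_trans; apply; rewrite ltr_pM2l//; lra.
(* This is the difference of the two squares: [c] is nonzero and of sign opposite to [p * q]. *)
have : c * (c + 2 * (p * q)) < 0 by nra.
by move: (p * q) => r hr; apply/idP/idP => ?; nra.
Qed.

(** By [mink_lt0], the time coordinates of [x] and [y] both have the sign of that of [v], so their
    product is positive. *)
Lemma future_mink_lt0 v x y : timelike v -> timelike y -> future_directed v y ->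
  causal x -> future_directed v x -> mink x y < 0.
Proof.
rewrite /future_directed => tv ty fy cx fx.
have cy : causal y by rewrite /causal /spacelike; apply/negP; rewrite -leNgt ltW.
move: fx fy; rewrite !mink_lt0//.
move: (x _ _) (y _ _) (v _ _) => a b c; nra.
Qed.

(** Up to the factor [mink y y], [z] is the part of [x] orthogonal to [y]. The form is nonnegative
    on the orthogonal complement of a timelike vector, and [mink z z] is [mink y y] times the
    difference of the two sides. *)
Lemma reverse_cauchy_schwarz x y : timelike y ->
  mink x x * mink y y <= mink x y ^+ 2.
Proof.
rewrite /timelike => ty.
pose z := mink y y *: x - mink x y *: y.
have zy : mink z y = 0.
  by rewrite /z minkDl minkNl !minkZl mulrC subrr.
have zz : mink z z = mink y y * (mink y y * mink x x - mink x y ^+ 2).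
  rewrite {2}/z minkDr -scaleNr !minkZr zy mulr0 addr0.
  by rewrite /z minkDl minkNl !minkZl (minkC y x); ring.
suff : 0 <= mink z z by rewrite zz nmulr_rge0// subr_le0 mulrC.
have := spatial_cauchy_schwarz z y.
have := spatial_ge0 z; have := spatial_ge0 y.
rewrite zy add0r.
move: (mink z z) (mink y y) (z _ _) (y _ _) ty => a b p q b0 bq ap h.
rewrite leNgt; apply/negP => a0.
have p2 : 0 < p ^+ 2 by lra.
have : (a + p ^+ 2) * (b + q ^+ 2) <= (a + p ^+ 2) * q ^+ 2.
  by apply: ler_wpM2l => //; lra.
rewrite exprMn in h => /(le_trans h).
have [q00|q0] := eqVneq q 0; first by move=> _; rewrite q00 expr0n addr0 in bq; lra.
have q2 : 0 < q ^+ 2 by rewrite exprn_even_gt0//= q0 orbT.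
by rewrite ler_pM2r//; lra.
Qed.

Lemma timelike_causal x : timelike x -> causal x.
Proof. by rewrite /causal /spacelike => /ltW; rewrite leNgt => /negP. Qed.

Lemma timelikeZ r x : r != 0 -> timelike x -> timelike (r *: x).
Proof.
move=> r0; rewrite /timelike minkZl minkZr mulrA => tx.
by rewrite pmulr_rlt0// -expr2 exprn_even_gt0//= r0.
Qed.

Lemma future_directedZ v r x : 0 < r -> future_directed v x ->
  future_directed v (r *: x).
Proof. by rewrite /future_directed minkZl => r0; rewrite pmulr_rlt0. Qed.

(** Up to a positive factor, the velocity of a curve rescaled by an exponential has the form
    [x + s *: y]. The condition is its square without the nonpositive term in [s ^+ 2]; the case of
    negative [s] is the one that matters. *)
Lemma timelike_future_addZ v x y s : timelike v ->
  causal x -> future_directed v x -> timelike y -> future_directed v y ->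
  mink x x + 2 * s * mink x y < 0 ->
  timelike (x + s *: y) /\ future_directed v (x + s *: y).
Proof.
move=> tv cx fx ty fy h.
have B := future_mink_lt0 tv ty fy cx fx.
have rcs := reverse_cauchy_schwarz x ty.
have cx0 : mink x x <= 0 by move/negP : cx; rewrite -leNgt.
have tw : timelike (x + s *: y).
  rewrite /timelike minkDl !minkDr !minkZl !minkZr (minkC y x).
  have : s * (s * mink y y) <= 0 by rewrite mulrA mulr_ge0_le0// -?expr2 ?sqr_ge0// ltW.
  lra.
split=> //.
(* Otherwise [- (x + s *: y)] would be future-directed and have negative product with [y]; this
   forces [s < 0] and then contradicts the reverse Cauchy-Schwarz inequality. *)
rewrite /future_directed ltNge; apply/negP => pw.
have {}pw : 0 < mink (x + s *: y) v.
  rewrite lt_neqAle pw andbT eq_sym; apply/eqP => w0.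
  have := reverse_cauchy_schwarz (x + s *: y) tv; rewrite w0 expr0n/=.
  by rewrite leNgt nmulr_rgt0// tv.
have tNw : timelike (- (x + s *: y)) by rewrite -scaleN1r; exact: timelikeZ.
have fNw : future_directed v (- (x + s *: y)) by rewrite /future_directed minkNl oppr_lt0.
have := future_mink_lt0 tv ty fy (timelike_causal tNw) fNw.
rewrite minkNl minkDl minkZl; rewrite /timelike in ty.
move: (mink x x) (mink x y) (mink y y) ty h B rcs cx0 => a b c c0 h b0 rcs a0 hh.
have s0 : s < 0.
  by rewrite ltNge; apply/negP => s0; have := mulr_ge0_le0 s0 (ltW c0); lra.
have h1 : 2 * s * b < - a by lra.
have h2 : b * (2 * s * b) > b * (- a) by rewrite ltr_nM2l.
nra.
Qed.

Lemma mnorm_future v x : timelike v -> causal x -> future_directed v x ->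
  mnorm x * mnorm v <= - mink x v.
Proof.
move=> tv cx fx; have cx0 : mink x x <= 0 by move/negP : cx; rewrite -leNgt.
rewrite -sqrtrM// -(ger0_norm (_ : 0 <= - mink x v)); last by rewrite oppr_ge0 ltW.
rewrite -[leRHS]sqrtr_sqr; apply: ler_wsqrtr; rewrite sqrrN.
by rewrite !ler0_norm// ?mulrNN ?reverse_cauchy_schwarz// ltW.
Qed.

Lemma mnorm_ge0 x : 0 <= mnorm x.
Proof. exact: sqrtr_ge0. Qed.

Lemma mnormZ r x : 0 <= r -> mnorm (r *: x) = r * mnorm x.
Proof.
move=> r0; rewrite /mnorm minkZl minkZr mulrA -expr2 normrM.
by rewrite sqrtrM// ger0_norm ?sqr_ge0// sqrtr_sqr (ger0_norm r0).
Qed.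

Lemma mnorm_timelike x : timelike x -> 0 < mnorm x.
Proof. by rewrite /timelike => tx; rewrite sqrtr_gt0 normr_gt0 lt_eqF. Qed.

Lemma coord_le_norm x i : `|x ord0 i| <= `|x|.
Proof.
rewrite [leRHS]/Num.Def.normr/= mx_normrE.
exact: (le_bigmax _ (fun ij => `|x ij.1 ij.2|) (ord0, i)).
Qed.

Lemma mink_bound x y : `|mink x y| <= n.+1%:R * (`|x| * `|y|).
Proof.
have h i : `|x ord0 i * y ord0 i| <= `|x| * `|y|.
  by rewrite normrM ler_pM// coord_le_norm.
rewrite /mink -nat1r mulrDl mul1r (le_trans (ler_normD _ _))// lerD//.
  by rewrite normrN.
rewrite (le_trans (ler_norm_sum _ _ _))//.
rewrite (le_trans (ler_sum _ (fun i _ => h (lift ord0 i))))//.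
by rewrite sumr_const card_ord -[leLHS]mulr_natl.
Qed.

End MinkowskiAlgebra.

(** * Local Lipschitz continuity on intervals *)

Section LocallyLipschitz.
Context {R : realType} {V : normedModType R}.
Implicit Types (f : R -> V) (I : set R).

(** The local Lipschitz predicate speaks of neighbourhoods of pairs, off the diagonal as well, so
    [s] and [t] may differ. *)
Lemma locally_lipschitz_near f I s t :
  [locally [lipschitz (f : R^o -> V) x | x in (I : set R^o)]] -> I s -> I t ->
  exists2 K, 0 <= K & exists2 e, 0 < e & forall x y, I x -> I y ->
    `|x - s| < e -> `|y - t| < e -> `|f x - f y| <= K * `|x - y|.
Proof.
move=> /(_ (s, t)) h Is It; have {}h := h (conj Is It).
have [K [K0]] := (pinfty_ex_gt0 h).
rewrite /dominated_by /within/= => /nbhs_ballP[e /= e0 he].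
exists K; first exact: ltW.
exists e => // x y Ix Iy xs yt.
apply: (he (x, y)) => //=; split => /=; by rewrite -ball_normE /= distrC.
Qed.

Lemma locally_lipschitz_near_continuous f I :
  [locally [lipschitz (f : R^o -> V) x | x in (I : set R^o)]] ->
  forall t e, I t -> 0 < e -> exists2 d, 0 < d &
    forall x, I x -> `|x - t| < d -> `|f x - f t| < e.
Proof.
move=> lf t e It e0.
have [K K0 [d d0 h]] := locally_lipschitz_near lf It It.
exists (Num.min d (e / (K + 1))).
  by rewrite lt_min d0 divr_gt0// ltr_wpDl.
move=> x Ix; rewrite lt_min ltr_pdivlMr ?ltr_wpDl// => /andP[xd xe].
apply: le_lt_trans (h _ _ Ix It xd _) _; first by rewrite subrr normr0.
apply: le_lt_trans xe; rewrite mulrC ler_wpM2l// lerDl//.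
Qed.

(** Compactness of the square [[a, b] * [a, b]], in its covering form with a constant [K] tending to
    infinity: [K] eventually exceeds the local constants everywhere. *)
Lemma lipschitz_segment f (a b : R) :
  [locally [lipschitz (f : R^o -> V) x | x in (`[a, b]%classic : set R^o)]] ->
  exists2 K, 0 <= K & forall x y, a <= x <= b -> a <= y <= b ->
    `|f x - f y| <= K * `|x - y|.
Proof.
move=> lf.
have cI : compact (`[a, b]%classic `*` `[a, b]%classic : set (R * R)).
  by apply: compact_setX; exact: segment_compact.
pose P (K : R) (p : R * R) := `[a, b]%classic p.1 -> `[a, b]%classic p.2 ->
  `|f p.1 - f p.2| <= K * `|p.1 - p.2|.
have /(_ _ (@pinfty_nbhs R) P) := (compact_near_coveringP _).1 cI.
case.
  move=> [s t] [/= Is It].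
  have [K K0 [e e0 h]] := locally_lipschitz_near lf Is It.
  exists (ball (s, t) e, [set M | K < M]) => /=.
    split; first exact: nbhsx_ballx.
    by exists K; split => //; exact: num_real.
  move=> [[x y] M] /= [[xs yt] KM] Ix Iy /=.
  rewrite -ball_normE/= distrC in xs; rewrite -ball_normE/= distrC in yt.
  apply: le_trans (h _ _ Ix Iy xs yt) _; by rewrite ler_wpM2r// ltW.
move=> K [Kr hK]; exists (`|K| + 1) => // x y Ix Iy.
have /(_ _ (x, y)) := hK (`|K| + 1).
apply => //=.
by rewrite (le_lt_trans (ler_norm K))// ltrDl.
Qed.

(** The constant may grow with [c], as it does for curves multiplied by an exponential. *)
Lemma lipschitz_bounded_locally f I :
  (forall c, exists2 K, 0 <= K & forall x y, I x -> I y -> `|x| <= c -> `|y| <= c ->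
    `|f x - f y| <= K * `|x - y|) ->
  [locally [lipschitz (f : R^o -> V) x | x in (I : set R^o)]].
Proof.
move=> h [s t] [Is It].
pose c := Num.max `|s| `|t| + 1.
have [K K0 hK] := h c.
exists K; split; first exact: num_real.
move=> M KM; rewrite /dominated_by /within/=; apply/nbhs_ballP.
exists 1 => //= -[x y] [/= xs yt] [/= Ix Iy].
rewrite -ball_normE/= distrC in xs; rewrite -ball_normE/= distrC in yt.
apply: le_trans (hK _ _ Ix Iy _ _) _.
- rewrite -(subrK s x) (le_trans (ler_normD _ _))// addrC lerD ?(ltW xs)//.
  by rewrite le_max lexx.
- rewrite -(subrK t y) (le_trans (ler_normD _ _))// addrC lerD ?(ltW yt)//.
  by rewrite le_max lexx orbT.
- by rewrite ler_wpM2r// ltW.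
Qed.

End LocallyLipschitz.

(** * The fundamental theorem of calculus for Lipschitz functions *)

Section LipschitzFTC.
Context {R : realType}.
Local Notation mu := (@lebesgue_measure R).
Implicit Types (f g h : R -> R) (a b K : R).

(** A difference quotient with steps along a sequence, so that limits preserve measurability and
    dominated convergence applies. *)
Definition growth_rate g (n : nat) (t : R) : R :=
  n.+1%:R * (g (n.+1%:R^-1 + t) - g t).

Lemma growth_rate_cvg g (t d : R) : is_derive t 1 g d ->
  growth_rate g ^~ t @ \oo --> d.
Proof.
move=> [dg dgE].
have : (h^-1 *: (g (h *: 1 + t) - g t)) @[h --> 0^'] --> d.
  by rewrite -dgE; exact: dg.
move=> cg.
have ch : (@harmonic R) @ \oo --> 0^'.
  move=> A /= [e /= e0 eA].
  have := (@cvg_harmonic R).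
  move/cvgrPdist_lt => /(_ e e0); apply: filterS => n /= hn.
  apply: eA => /=; first by [].
  by rewrite /harmonic invr_neq0.
have := cvg_comp _ _ ch cg; apply: cvg_trans; apply: near_eq_cvg.
by near=> n; rewrite /growth_rate /= /harmonic invrK [_ *: 1]mulr1.
Unshelve. all: by end_near. Qed.

Lemma continuous_growth_rate g n : continuous g -> continuous (growth_rate g n).
Proof.
move=> cg t; apply: cvgM; first exact: cvg_cst.
apply: cvgB; last exact: cg.
have c1 : (fun x : R => n.+1%:R^-1 + x) @ t --> n.+1%:R^-1 + t.
  by apply: cvgD; [exact: cvg_cst|exact: cvg_id].
exact: cvg_comp c1 (cg _).
Qed.

Lemma lipschitz_continuous g K : (forall x y, `|g x - g y| <= K * `|x - y|) ->
  continuous g.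
Proof.
move=> lg t; apply/cvgrPdist_lt => e e0.
have K1 : 0 < `|K| + 1 by rewrite ltr_wpDl.
near=> x.
apply: le_lt_trans (lg _ _) _.
apply: (@le_lt_trans _ _ ((`|K| + 1) * `|t - x|)).
  by rewrite ler_wpM2r// (le_trans (ler_norm K))// lerDl.
rewrite mulrC -ltr_pdivlMr//; near: x.
exact: (@cvgr_dist_lt _ _ _ (nbhs t) _ id t cvg_id _ (divr_gt0 e0 K1)).
Unshelve. all: by end_near. Qed.

Lemma continuous_primitive g a b : continuous g ->
  exists G : R -> R, forall x, a < x < b -> is_derive x 1 G (g x).
Proof.
move=> cg; pose G x := (\int[mu]_(t in `[a, x]) g t)%R.
exists G => x /andP[ax xb].
have ig : mu.-integrable `[a, b] (EFin \o g).
  apply: continuous_compact_integrable; first exact: segment_compact.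
  exact: continuous_subspaceT.
have [dG GE] := continuous_FTC1_closed xb ig ax (cg x).
by split; [exact: dG|rewrite -derive1E; exact: GE].
Qed.

(** Integrating the quotient of [g] gives the quotient of a primitive [G] at [b] minus that at [a],
    and these tend to [g b] and [g a]. *)
Lemma integral_growth_rate g a b : a < b -> continuous g ->
  (\int[mu]_(t in `[a, b]) (growth_rate g n t)%:E)%E @[n --> \oo] -->
  (g b - g a)%:E.
Proof.
move=> ab cg.
(* The quotients look up to [1] to the right, so [G] must be differentiable up to [b + 1], and at
   [a] itself. *)
have [G dG] := continuous_primitive (a - 1) (b + 2) cg.
have dGx x : a - 1 < x < b + 2 -> {for x, continuous G}.
  move=> /dG ?; apply/differentiable_continuous/derivable1_diffP.
  exact: ex_derive.
suff E n : (\int[mu]_(t in `[a, b]) (growth_rate g n t)%:E =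
    (growth_rate G n b - growth_rate G n a)%:E)%E.
  under eq_fun do rewrite E.
  apply: cvg_EFin; first exact: nearW.
  by apply: cvgB; apply: growth_rate_cvg; apply: dG; lra.
have h0 : 0 < n.+1%:R^-1 :> R by [].
have h1 : n.+1%:R^-1 <= 1 :> R by rewrite invf_le1// ler1n.
have dGr x : a <= x <= b -> is_derive x 1 (growth_rate G n) (growth_rate g n x).
  move=> /andP[ax xb].
  have dGx0 : is_derive x 1 G (g x) by apply: dG; lra.
  have dGx1 : is_derive (n.+1%:R^-1 + x) 1 G (g (n.+1%:R^-1 + x)).
    by apply: dG; move: h0 h1; move: (_^-1) => q q0 q1; lra.
  have dsh : is_derive x 1 (fun t : R => n.+1%:R^-1 + t) 1.
    have := @is_deriveD R R R _ _ x 1 _ _ (is_derive_cst (n.+1%:R^-1 : R) x 1) (is_derive_id x 1).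
    by rewrite add0r.
  have dc := @is_derive1_comp _ G _ x _ _ dGx1 dsh.
  rewrite mulr1 in dc.
  have := @is_deriveB _ _ _ _ _ _ _ _ _ dc dGx0.
  move=> dB; have := @is_deriveZ _ _ _ _ n.+1%:R _ _ _ dB.
  by [].
have cGr x : a <= x <= b -> {for x, continuous (growth_rate G n)}.
  move=> /dGr ?; apply/differentiable_continuous/derivable1_diffP.
  exact: ex_derive.
rewrite (@continuous_FTC2 _ _ (growth_rate G n))//.
- by apply: continuous_subspaceT; exact: continuous_growth_rate.
- split.
  + move=> x; rewrite in_itv/= => /andP[ax xb].
    have dx : is_derive x 1 (growth_rate G n) (growth_rate g n x) by apply: dGr; lra.
    exact: ex_derive.
  + by apply: cvg_at_right_filter; apply: cGr; lra.
  + by apply: cvg_at_left_filter; apply: cGr; lra.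
- move=> x; rewrite in_itv/= => /andP[ax xb].
  have dx : is_derive x 1 (growth_rate G n) (growth_rate g n x) by apply: dGr; lra.
  by rewrite derive1E derive_val.
Qed.

Lemma integrable_segment a b f K : measurable_fun `[a, b] f ->
  (forall t, a <= t <= b -> `|f t| <= K) -> mu.-integrable `[a, b] (EFin \o f).
Proof.
move=> mf fK; apply: measurable_bounded_integrable => //.
  by rewrite /= lebesgue_measure_itv; case: ifP => _; rewrite /= ?ltry// -EFinD ltry.
exists K; split; first exact: num_real.
move=> M KM t /=; rewrite in_itv/= => /fK /le_trans; apply; exact: ltW.
Qed.

Lemma ae_neq a : {ae mu, forall t, t != a}.
Proof.
exists [set a]; split=> //; first exact: lebesgue_measure_set1.
by move=> t /= /negP; rewrite negbK => /eqP.
Qed.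

(** The difference quotients of [g] are bounded by [K] and tend to [h] almost everywhere; dominated
    convergence identifies the limit of their integrals. *)
Lemma lipschitz_FTC g h a b K : a < b ->
  (forall x y, `|g x - g y| <= K * `|x - y|) ->
  measurable_fun `[a, b] h ->
  {ae mu, forall t, a < t < b -> is_derive t 1 g (h t)} ->
  mu.-integrable `[a, b] (EFin \o h) /\
  (\int[mu]_(t in `[a, b]) (h t)%:E = (g b - g a)%:E)%E.
Proof.
move=> ab lg mh dg.
have cg := lipschitz_continuous lg.
have K0 : 0 <= K.
  have := lg 0 1; rewrite sub0r normrN normr1 mulr1.
  exact: le_trans.
have := @dominated_convergence _ _ _ mu `[a, b] (measurable_itv _)
  (fun n t => (growth_rate g n t)%:E) (EFin \o h) (cst K%:E).
case.
- move=> n; apply/measurable_EFinP.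
  by apply: measurable_funTS; apply: continuous_measurable_fun; exact: continuous_growth_rate.
- exact/measurable_EFinP.
- apply: filterS3 (ae_neq a) (ae_neq b) dg.
    exact: (ae_filter_ringOfSetsType mu).
  move=> t ta tb h1.
  rewrite /= in_itv/= => /andP[at_ tb_].
  apply: cvg_EFin; first exact: nearW.
  by apply: growth_rate_cvg; apply: h1; rewrite !lt_neqAle eq_sym ta tb at_.
- by apply: (@integrable_segment _ _ (cst K) `|K|) => // t _ /=.
- apply: aeW => t n _; rewrite /= lee_fin /growth_rate normrM.
  rewrite ger0_norm//; apply: le_trans (ler_wpM2l _ (lg _ _)) _ => //.
  by rewrite addrK mulrCA ger0_norm// mulfV ?mulr1.
move=> ih _ cv; split=> //.
apply: (@cvg_unique _ _ _ _ _ _ cv (integral_growth_rate ab cg)).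
exact: ereal_hausdorff.
Qed.

End LipschitzFTC.

(** * Changing a possibly nonmeasurable integrand on a null set *)

Section NonmeasurableIntegral.
Local Open Scope ereal_scope.
Context d (T : measurableType d) (R : realType).
Variable mu : {measure set T -> \bar R}.
Import HBNNSimple.

(* No measurability of [f] and [g]: a simple function below [f] stays a simple
   function of the same integral once it is set to zero on a null set. *)
Lemma ge0_ae_le_integral_nonmeasurable (D N : set T) (f g : T -> \bar R) :
  measurable N -> mu N = 0 ->
  (forall x, D x -> 0 <= f x) -> (forall x, D x -> 0 <= g x) ->
  (forall x, D x -> ~ N x -> f x <= g x) ->
  \int[mu]_(x in D) f x <= \int[mu]_(x in D) g x.
Proof.
move=> mN N0 f0 g0 fg; rewrite !ge0_integralE//.
apply: ge_ereal_sup => _ [h/= hf <-].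
apply: le_ereal_sup_tmp.
pose h' := proj_nnsfun h (measurableC mN).
have h'E x : h' x = (h x * \1_(~` N) x)%R by [].
exists (sintegral mu h').
  exists h' => // x; rewrite h'E indicE.
  have [xN|xN] := pselect (N x).
    rewrite memNset/=; last by move=> /(_ xN).
    by rewrite mulr0 patchE; case: ifPn => // /set_mem; exact: g0.
  rewrite mem_set//= mulr1; apply: le_trans (hf x) _; rewrite !patchE.
  by case: ifPn => // /set_mem Dx; exact: fg.
rewrite -!integralT_nnsfun; rewrite le_eqVlt; apply/orP; left; apply/eqP/ge0_ae_eq_integral => //.
- exact/measurable_EFinP.
- exact/measurable_EFinP.
- by move=> x _; rewrite lee_fin.
- by move=> x _; rewrite lee_fin.
exists N; split => // x hx; apply: contrapT => xN; apply: hx => _.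
by rewrite h'E indicE mem_set ?mulr1.
Qed.

(** This allows [curve_length], whose integrand uses the raw derivative, to be computed with a
    measurable velocity. *)
Lemma ge0_ae_eq_integral_nonmeasurable (D N : set T) (f g : T -> \bar R) :
  measurable N -> mu N = 0 ->
  (forall x, D x -> 0 <= f x) -> (forall x, D x -> 0 <= g x) ->
  (forall x, D x -> ~ N x -> f x = g x) ->
  \int[mu]_(x in D) f x = \int[mu]_(x in D) g x.
Proof.
move=> mN N0 f0 g0 fg; apply/eqP; rewrite eq_le.
apply/andP; split; apply: (ge0_ae_le_integral_nonmeasurable mN) => // x Dx Nx.
  by rewrite fg.
by rewrite -fg.
Qed.

End NonmeasurableIntegral.

(** * Retraction of the line onto a segment *)

Section Clamp.
Context {R : realType}.
Implicit Types a b s t : R.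

(** Composition with it extends a curve on [[a, b]] to the whole line, constant on either side and
    with the same Lipschitz constant. *)
Definition clamp a b t := Num.max a (Num.min b t).

Lemma clamp_in a b t : a <= b -> a <= clamp a b t <= b.
Proof. by move=> ab; rewrite le_max lexx/= ge_max ab ge_min lexx. Qed.

Lemma clamp_id a b t : a <= t <= b -> clamp a b t = t.
Proof. by move=> /andP[at_ tb]; rewrite /clamp min_r// max_r. Qed.

Lemma clamp_left a b t : a <= b -> t <= a -> clamp a b t = a.
Proof. by move=> ab ta; rewrite /clamp min_r ?(le_trans ta)// max_l. Qed.

Lemma clamp_right a b t : a <= b -> b <= t -> clamp a b t = b.
Proof. by move=> ab bt; rewrite /clamp min_l// max_r. Qed.

Lemma clamp_lipschitz a b s t : a <= b ->
  `|clamp a b s - clamp a b t| <= `|s - t|.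
Proof.
move=> ab; wlog st : s t / s <= t.
  by move=> h; case/orP: (le_total s t) => [/h//|/h]; rewrite distrC (distrC t).
have [sa|as_] := leP s a; have [ta|at_] := leP t a.
- by rewrite !clamp_left// subrr normr0.
- rewrite clamp_left//; have [tb|bt] := leP t b.
    by rewrite clamp_id ?(ltW at_)// !ler0_norm; lra.
  by rewrite clamp_right ?(ltW bt)// !ler0_norm; lra.
- by have := le_trans st ta; rewrite leNgt as_.
- have [sb|bs] := leP s b; have [tb|bt] := leP t b.
  + by rewrite !clamp_id ?(ltW as_) ?(ltW at_).
  + by rewrite clamp_id ?(ltW as_)// clamp_right ?(ltW bt)// !ler0_norm; lra.
  + by have := le_trans st tb; rewrite leNgt bs.
  + by rewrite !(clamp_right ab) ?subrr ?normr0 ?(ltW bs) ?(ltW bt).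
Qed.

End Clamp.

(** * A bounded measurable velocity for causal curves *)

Section Velocity.
Context {R : realType} {n : nat} (v0 : 'rV[R]_n.+1).
Local Notation L := 'rV[R]_n.+1.
Local Notation mu := (@lebesgue_measure R).

(* [vel] is the derivative of [gamma] put to zero on a null set, so as to be
   Borel measurable and bounded everywhere, which [derive1 gamma] need not be. *)
Record velocity (a b K : R) (gamma vel : R -> L) : Prop := Velocity {
  vel_lt : a < b ;
  vel_lip : forall s t, `|gamma s - gamma t| <= K * `|s - t| ;
  vel_meas : forall i, measurable_fun setT (fun t => vel t ord0 i) ;
  vel_bound : forall t, `|vel t| <= K ;
  vel_derive : {ae mu, forall t : R, is_derive t 1 (gamma : R^o -> L) (vel t)} ;
  vel_out : forall t, ~ (a < t < b) -> vel t = 0 ;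
  vel_future : forall t,
    vel t = 0 \/ causal (vel t) /\ future_directed v0 (vel t) ;
  vel_ae_future : {ae mu, forall t, a < t < b ->
    causal (vel t) /\ future_directed v0 (vel t)} }.

Lemma norm_row_le (x : L) (K : R) : 0 <= K ->
  (forall i, `|x ord0 i| <= K) -> `|x| <= K.
Proof.
move=> K0 xK; rewrite [leLHS]/Num.Def.normr/= mx_normrE bigmax_le//=.
by move=> [i j] _ /=; rewrite ord1.
Qed.

(** Coordinatewise the velocity is a limit of difference quotients of the extended curve, which are
    continuous and bounded by the Lipschitz constant. *)
Lemma future_curve_velocity M a b gamma :
  future_curve v0 causal M `[a, b] gamma ->
  exists K vel, velocity a b K (gamma \o clamp a b) vel /\
    {ae mu, forall t, a <= t <= b -> derive1 gamma t = vel t}.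
Proof.
move=> [[_ I0] _ lg [N [mN N0 PN]]].
have ab : a < b.
  case: I0 => t; rewrite interior_itv/= in_itv/= => /andP[at_ tb].
  exact: lt_trans tb.
have [K K0 lK] := lipschitz_segment lg.
pose g := gamma \o clamp a b.
have lipg s t : `|g s - g t| <= K * `|s - t|.
  apply: le_trans (lK _ _ _ _) _; rewrite ?clamp_in ?(ltW ab)//.
  by rewrite ler_wpM2l// clamp_lipschitz// ltW.
(* [N] is the exceptional null set. The endpoints are left out too, since the derivative of [gamma]
   there sees values outside the segment. *)
pose D := `]a, b[%classic `\` N.
have mD : measurable D by exact: measurableD.
have DP t : D t -> [/\ a < t < b, is_derive t 1 (g : R^o -> L) (derive1 gamma t),
    causal (derive1 gamma t) & future_directed v0 (derive1 gamma t)].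
  move=> [/=]; rewrite in_itv/= => /andP[at_ tb] Nt.
  have [dt ct ft] : [/\ derivable (gamma : R^o -> L) t 1,
      causal (derive1 gamma t) & future_directed v0 (derive1 gamma t)].
    have := contra_not (@PN t) Nt; rewrite /= notK; apply.
    by rewrite in_itv/= !ltW.
  split; [by rewrite at_| |exact: ct|exact: ft].
  apply: (@near_eq_is_derive _ R^o _ gamma).
    have tab : t \in `]a, b[ by rewrite in_itv/= at_.
    have := near_in_itvoo tab; apply: filterS => s.
    by rewrite in_itv/= => /andP[as_ sb]; rewrite /g/= clamp_id// !ltW.
  by split; [exact: dt|rewrite derive1E].
pose vel t := if t \in D then derive1 gamma t else 0.
have velD t : D t -> vel t = derive1 gamma t by move=> Dt; rewrite /vel mem_set.
have velN t : ~ D t -> vel t = 0 by move=> Dt; rewrite /vel memNset.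
have lipgi i s t : `|g s ord0 i - g t ord0 i| <= K * `|s - t|.
  by apply: le_trans (lipg s t); have := coord_le_norm (g s - g t) i; rewrite !mxE.
have dgi t i : D t -> is_derive t 1 (fun t => g t ord0 i) (vel t ord0 i).
  move=> /[dup] Dt /DP[_ dg _ _].
  have ddg : derivable (g : R^o -> L) t 1 by exact: ex_derive.
  split; first by move/derivable_mxP : ddg; exact.
  have [_ gE] := dg.
  by rewrite velD// -gE (derive_mx ddg) mxE.
have velB t i : `|vel t ord0 i| <= K.
  have [Dt|Dt] := pselect (D t); last by rewrite velN// mxE normr0.
  have := growth_rate_cvg (dgi t i Dt) => cv.
  have gK k : `|growth_rate (fun t => g t ord0 i) k t| <= K.
    rewrite /growth_rate normrM ger0_norm//.
    apply: le_trans (ler_wpM2l _ (lipgi _ _ _)) _ => //.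
    by rewrite addrK mulrCA ger0_norm// mulfV ?mulr1.
  rewrite ler_norml; apply/andP; split.
    apply: (@cvgr_to_ge _ _ _ _ _ _ _ cv); apply: nearW => k.
    by have := gK k; rewrite ler_norml => /andP[].
  apply: (@cvgr_to_le _ _ _ _ _ _ _ cv); apply: nearW => k.
  by have := gK k; rewrite ler_norml => /andP[].
have aeD : {ae mu, forall t, a < t < b -> D t}.
  exists N; split=> // t /= /not_implyP[tab]; apply: contra_notP => Nt.
  by split=> //=; rewrite in_itv.
exists K, vel; split; first split=> //.
- move=> i.
  apply: (@measurable_fun_cvg _ _ _ _ (fun k t =>
    growth_rate (fun t => g t ord0 i) k t * \1_D t)).
    move=> k; apply: measurable_funM; last exact: measurable_indic.
    apply: continuous_measurable_fun; apply: continuous_growth_rate.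
    exact: lipschitz_continuous (lipgi i).
  move=> t _; have [Dt|Dt] := pselect (D t).
    rewrite indicE mem_set//=; under eq_fun do rewrite mulr1.
    exact: growth_rate_cvg (dgi t i Dt).
  rewrite indicE memNset//= velN// mxE; under eq_fun do rewrite mulr0.
  exact: cvg_cst.
- by move=> t; apply: norm_row_le.
- apply: filterS3 aeD (ae_neq a) (ae_neq b).
    exact: (ae_filter_ringOfSetsType mu).
  move=> t tD ta tb.
  have [at_|at_] := ltP a t; last first.
    have {}at_ : t < a by rewrite lt_neqAle ta.
    rewrite velN; last by move=> /DP[/andP[]]; rewrite ltNge (ltW at_).
    apply: (@near_eq_is_derive _ R^o _ (cst (gamma a))).
    have := lt_nbhsl at_; apply: filterS => s sa.
    by rewrite /= clamp_left// ltW.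
  have [tb'|tb'] := ltP t b.
    have Dt : D t by apply: tD; rewrite at_.
    by rewrite velD//; have [] := DP _ Dt.
  have {}tb' : b < t by rewrite lt_neqAle eq_sym tb.
  rewrite velN; last by move=> /DP[/andP[_]]; rewrite ltNge (ltW tb').
  apply: (@near_eq_is_derive _ R^o _ (cst (gamma b))).
  have := lt_nbhsr tb'; apply: filterS => s sa.
  by rewrite /= clamp_right// ltW.
- by move=> t tab; apply: velN => /DP[].
- move=> t; have [Dt|Dt] := pselect (D t); last by left; exact: velN.
  by right; rewrite velD//; have [] := DP _ Dt.
- apply: filterS aeD.
    exact: (ae_filter_ringOfSetsType mu).
  by move=> t tD /tD Dt; rewrite velD//; have [] := DP _ Dt.
- apply: filterS3 aeD (ae_neq a) (ae_neq b).
    exact: (ae_filter_ringOfSetsType mu).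
  move=> t tD ta tb /andP[at_ tb_].
  by rewrite velD//; apply: tD; rewrite !lt_neqAle at_ tb_ eq_sym ta tb.
Qed.

End Velocity.

(** * Additivity and bounds for the length of causal curves *)

Section VelocityIntegrals.
Context {R : realType} {n : nat} (v0 : 'rV[R]_n.+1).
Local Notation L := 'rV[R]_n.+1.
Local Notation mu := (@lebesgue_measure R).
Implicit Types (x w : L) (gamma vel : R -> L) (a b c t : R).

(** A single sum, linear in the coordinates of [x], lets differentiation and measurability go term
    by term. *)
Lemma mink_sum x w : mink x w =
  \sum_i x ord0 i * (if i == ord0 then - w ord0 ord0 else w ord0 i).
Proof. by rewrite big_ord_recl eqxx mulrN. Qed.

Lemma is_derive_coord gamma t (d : L) i : is_derive t 1 (gamma : R^o -> L) d ->
  is_derive t 1 (fun t => gamma t ord0 i) (d ord0 i).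
Proof.
move=> [dg gE]; split; first by move/derivable_mxP : dg; exact.
by rewrite -gE (derive_mx dg) mxE.
Qed.

Lemma is_derive_mink gamma t (d w : L) : is_derive t 1 (gamma : R^o -> L) d ->
  is_derive t 1 (fun t => mink (gamma t) w) (mink d w).
Proof.
move=> dg; pose k i := if i == ord0 then - w ord0 ord0 else w ord0 i.
have dk i : is_derive t 1 (k i *: (fun t => gamma t ord0 i) : R -> R)
    (k i *: d ord0 i : R).
  exact: (@is_deriveZ _ _ R _ _ _ _ _ (is_derive_coord i dg)).
have := @is_derive_sum _ _ R _ _ _ _ _ dk.
have -> : \sum_(i < n.+1) (k i *: (fun t => gamma t ord0 i) : R -> R) =
    fun t => mink (gamma t) w.
  apply/funext => s; rewrite fct_sumE mink_sum.
  by apply: eq_bigr => i _; rewrite mulrC.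
rewrite mink_sum; congr (is_derive _ _ _ _).
by apply: eq_bigr => i _; rewrite mulrC.
Qed.

Lemma measurable_mink (f g : R -> L) :
  (forall i, measurable_fun setT (fun t => f t ord0 i)) ->
  (forall i, measurable_fun setT (fun t => g t ord0 i)) ->
  measurable_fun setT (fun t => mink (f t) (g t)).
Proof.
move=> mf mg; under eq_fun do rewrite mink_sum.
apply: measurable_sum => i; apply: measurable_funM => //.
by case: eqVneq => // _; exact: measurable_funN.
Qed.

Lemma measurable_mnorm (f : R -> L) :
  (forall i, measurable_fun setT (fun t => f t ord0 i)) ->
  measurable_fun setT (fun t => mnorm (f t)).
Proof.
move=> mf; have ms := continuous_measurable_fun (@sqrt_continuous R).
apply: (measurableT_comp ms).
by apply: measurableT_comp => //; exact: measurable_mink.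
Qed.

Lemma integral_mnorm_velocity a b (D : set R) gamma vel :
  D `<=` `[a, b] -> {ae mu, forall t, a <= t <= b -> derive1 gamma t = vel t} ->
  (\int[mu]_(t in D) (mnorm (derive1 gamma t))%:E =
   \int[mu]_(t in D) (mnorm (vel t))%:E)%E.
Proof.
move=> Dab [N [mN N0 PN]].
apply: (ge0_ae_eq_integral_nonmeasurable mN) => //.
- by move=> t _; rewrite lee_fin mnorm_ge0.
- by move=> t _; rewrite lee_fin mnorm_ge0.
move=> t /Dab/=; rewrite in_itv/= => tab Nt.
have := contra_not (@PN t) Nt; rewrite /= notK => /(_ tab) ->.
by [].
Qed.

Lemma curve_length_split M a b c gamma :
  future_curve v0 causal M `[a, c] gamma -> a <= b -> b <= c ->
  (curve_length a c gamma = curve_length a b gamma + curve_length b c gamma)%E.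
Proof.
move=> fg ab bc; have [K [vel [V ae]]] := future_curve_velocity fg.
have sab : `[a, b] `<=` `[a, c].
  by move=> t /=; rewrite !in_itv/= => /andP[-> tb]; exact: le_trans tb bc.
have sbc : `[b, c] `<=` `[a, c].
  by move=> t /=; rewrite !in_itv/= => /andP[/(le_trans ab)-> ->].
rewrite /curve_length (integral_mnorm_velocity (@subset_refl _ `[a, c]) ae).
rewrite (integral_mnorm_velocity sab ae) (integral_mnorm_velocity sbc ae).
have mv := measurable_mnorm (vel_meas V).
rewrite -[X in (_ + X)%E]integral_itv_obnd_cbnd; last first.
  by apply/measurable_EFinP; exact: measurable_funTS.
rewrite -ge0_integral_setU//=.
- by rewrite -itv_bndbnd_setU.
- by apply/measurable_EFinP; exact: measurable_funTS.
- by move=> t _; rewrite lee_fin mnorm_ge0.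
- rewrite disj_set2E; apply/eqP/seteqP; split=> // t /=.
  by rewrite !in_itv/= => -[/andP[_ tb] /andP[bt _]]; rewrite leNgt bt in tb.
Qed.

(** By [mnorm_future] the integrand is at most the derivative of [- mink (gamma t) v0] divided by
    [mnorm v0], to which [lipschitz_FTC] applies. *)
Lemma curve_length_bound M a b gamma : timelike v0 ->
  future_curve v0 causal M `[a, b] gamma ->
  (curve_length a b gamma <=
    ((mnorm v0)^-1 * (mink (gamma a) v0 - mink (gamma b) v0))%:E)%E.
Proof.
move=> tv fg; have [K [vel [V ae]]] := future_curve_velocity fg.
have ab := vel_lt V.
have m0 : 0 < mnorm v0 by exact: mnorm_timelike.
rewrite /curve_length (integral_mnorm_velocity _ ae)//.
pose c := - (mnorm v0)^-1.
pose h t := c * mink (vel t) v0.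
pose g t := c * mink (gamma (clamp a b t)) v0.
have mh : measurable_fun setT h.
  apply: measurable_funM => //; apply: measurable_mink; first exact: vel_meas V.
  by move=> i.
have [ih] : mu.-integrable `[a, b] (EFin \o h) /\
    (\int[mu]_(t in `[a, b]) (h t)%:E = (g b - g a)%:E)%E.
  apply: (@lipschitz_FTC _ _ _ _ _ (`|c| * (n.+1%:R * `|v0|) * K)) => //.
  - move=> s t; rewrite -mulrBr normrM -!mulrA ler_wpM2l//.
    rewrite -minkNl -minkDl (le_trans (mink_bound _ _))// ler_wpM2l//.
    by rewrite mulrC ler_wpM2l// (le_trans (vel_lip V s t)).
  - exact: measurable_funTS.
  - apply: filterS (vel_derive V).
      exact: (ae_filter_ringOfSetsType mu).
    move=> t dt _.
    exact: (@is_deriveZ _ _ R _ c _ _ _ (is_derive_mink v0 dt)).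
have -> : g b - g a = (mnorm v0)^-1 * (mink (gamma a) v0 - mink (gamma b) v0).
  rewrite /g !clamp_id ?lexx ?(ltW ab)// /c; ring.
move=> <-; apply: ge0_le_integral => //.
- by move=> t _; rewrite lee_fin mnorm_ge0.
- by apply/measurable_EFinP/measurable_funTS; exact: measurable_mnorm (vel_meas V).
- by apply/measurable_EFinP; exact: measurable_funTS.
- move=> t _; rewrite lee_fin /h /c mulNr -mulrN mulrC ler_pdivlMr//.
  case: (vel_future V t) => [->|[ct ft]]; last exact: mnorm_future.
  by rewrite /mnorm !mink0l normr0 sqrtr0 mul0r oppr0.
Qed.

End VelocityIntegrals.

(** * Restriction and gluing of curves, Lorentzian distance, and ray segments *)

Section Curves.
Context {R : realType} {n : nat} (v0 : 'rV[R]_n.+1).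
Local Notation L := 'rV[R]_n.+1.
Local Notation mu := (@lebesgue_measure R).
Implicit Types (P : L -> Prop) (M : set L) (u v w : L) (a b c r t : R).
Implicit Types (gamma delta : R -> L).

Lemma future_curve_lt P M a b gamma :
  future_curve v0 P M `[a, b] gamma -> a < b.
Proof.
move=> [[_ [t ti]] _ _ _]; move: ti; rewrite interior_itv/= in_itv/= => /andP[at_ tb].
exact: lt_trans tb.
Qed.

Lemma future_curve_in P M a b gamma t : future_curve v0 P M `[a, b] gamma ->
  a <= t <= b -> M (gamma t).
Proof. by move=> [_ gM _ _] tab; apply: gM; exists t => //=; rewrite in_itv. Qed.

Lemma future_curve_sub P M a b a' b' gamma :
  future_curve v0 P M `[a, b] gamma -> a <= a' -> a' < b' -> b' <= b ->
  future_curve v0 P M `[a', b'] gamma.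
Proof.
move=> [_ gM lg dg] aa' ab' bb'.
have sub : `[a', b'] `<=` `[a, b].
  move=> t /=; rewrite !in_itv/= => /andP[a't tb'].
  by rewrite (le_trans aa')// (le_trans tb').
split.
- split; first exact: interval_is_interval.
  exists ((a' + b') / 2); rewrite interior_itv/= in_itv/=.
  by rewrite midf_lt//= midf_lt.
- by move=> _ [t It <-]; apply: gM; exists t => //; exact: sub.
- have [K K0 lK] := lipschitz_segment lg.
  apply: lipschitz_bounded_locally => e; exists K => // x y Ix Iy _ _.
  by apply: lK; [have := sub x Ix|have := sub y Iy]; rewrite /= in_itv.
- apply: filterS dg; first exact: (ae_filter_ringOfSetsType mu).
  by move=> t h It; exact: h (sub _ It).
Qed.

Lemma derive_eq_on_itv a b gamma delta t :
  (forall s, a < s < b -> gamma s = delta s) -> a < t < b ->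
  (derivable (gamma : R^o -> L) t 1 -> derivable (delta : R^o -> L) t 1) /\
  derive1 gamma t = derive1 delta t.
Proof.
move=> gd tab.
have nr : \forall s \near t, gamma s = delta s.
  have tI : t \in `]a, b[ by rewrite in_itv.
  by have := near_in_itvoo tI; apply: filterS => s; rewrite in_itv; exact: gd.
split; first exact: near_eq_derivable nr.
by rewrite !derive1E; exact: near_eq_derive nr.
Qed.

Lemma future_curve_eq P M a b gamma delta :
  (forall t, a <= t <= b -> gamma t = delta t) ->
  future_curve v0 P M `[a, b] gamma -> future_curve v0 P M `[a, b] delta.
Proof.
move=> gd [I gM lg dg]; split; first exact: I.
- move=> _ [t /= + <-]; rewrite in_itv/= => tab; rewrite -gd//.
  by apply: gM; exists t => //=; rewrite in_itv.
- have [K K0 lK] := lipschitz_segment lg.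
  apply: lipschitz_bounded_locally => e; exists K => // x y /=.
  by rewrite !in_itv/= => xab yab _ _; rewrite -!gd//; exact: lK.
(* The curves may differ outside [[a, b]], so their derivatives are compared in the interior
   only. *)
- apply: filterS3 dg (ae_neq a) (ae_neq b).
    exact: (ae_filter_ringOfSetsType mu).
  move=> t h ta tb It; have [h1 h2 h3] := h It.
  have tab : a < t < b.
    by move: It; rewrite /= in_itv/= !lt_neqAle => /andP[-> ->]; rewrite eq_sym ta tb.
  have gd' s : a < s < b -> gamma s = delta s.
    by move=> /andP[as_ sb]; apply: gd; rewrite !ltW.
  have [d1 d2] := derive_eq_on_itv gd' tab.
  by split; [exact: d1|rewrite -d2; exact: h2|rewrite -d2; exact: h3].
Qed.

Lemma curve_length_eq a b gamma delta :
  (forall t, a < t < b -> gamma t = delta t) ->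
  curve_length a b gamma = curve_length a b delta.
Proof.
move=> gd; rewrite /curve_length.
have mN : measurable ([set a] `|` [set b] : set (measurableTypeR R)).
  exact: measurableU.
apply: (ge0_ae_eq_integral_nonmeasurable mN).
- have s0 c : mu [set c] = 0%E := lebesgue_measure_set1 c.
  exact: (null_set_setU _ _ (s0 a) (s0 b)).
- by move=> t _; rewrite lee_fin mnorm_ge0.
- by move=> t _; rewrite lee_fin mnorm_ge0.
move=> t /=; rewrite in_itv/= => /andP[at_ tb] /not_orP[ta tb'].
have tab : a < t < b.
  by rewrite !lt_neqAle at_ tb !andbT eq_sym; apply/andP; split; apply/eqP.
by have [_ ->] := derive_eq_on_itv gd tab.
Qed.

(** Parameters on different sides of [b] are compared through [gamma b], which gives the Lipschitz
    constant [K1 + K2]. *)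
Lemma future_curve_glue P M a b c gamma :
  future_curve v0 P M `[a, b] gamma -> future_curve v0 P M `[b, c] gamma ->
  future_curve v0 P M `[a, c] gamma.
Proof.
move=> g1 g2; have ab := future_curve_lt g1; have bc := future_curve_lt g2.
have g1M t := @future_curve_in _ _ _ _ _ t g1.
have g2M t := @future_curve_in _ _ _ _ _ t g2.
move: g1 g2 => [_ _ l1 d1] [_ _ l2 d2].
split.
- split; first exact: interval_is_interval.
  exists b; rewrite interior_itv/= in_itv/=; exact/andP.
- move=> _ [t /= + <-]; rewrite in_itv/= => /andP[at_ tc].
  have [tb|/ltW bt] := leP t b; first by apply: g1M; rewrite at_.
  by apply: g2M; rewrite bt.
- have [K1 K10 lK1] := lipschitz_segment l1.
  have [K2 K20 lK2] := lipschitz_segment l2.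
  apply: lipschitz_bounded_locally => e; exists (K1 + K2); first exact: addr_ge0.
  suff h x y : a <= x -> x <= y -> y <= c ->
      `|gamma x - gamma y| <= (K1 + K2) * `|x - y|.
    move=> x y /=; rewrite !in_itv/= => /andP[ax xc] /andP[ay yc] _ _.
    case/orP: (le_total x y) => [xy|yx]; first exact: h.
    by rewrite distrC (distrC x); exact: h.
  move=> ax xy yc.
  have [yb|by_] := leP y b.
    apply: le_trans (lK1 x y _ _) _; rewrite ?ax ?yb ?(le_trans xy)//.
      by rewrite (le_trans ax).
    by rewrite ler_wpM2r// lerDl.
  have [xb|bx] := leP x b; last first.
    apply: le_trans (lK2 x y _ _) _; rewrite ?(ltW bx) ?(ltW by_) ?yc ?(le_trans xy)//.
    by rewrite ler_wpM2r// lerDr.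
  rewrite -(subrK (gamma b) (gamma x)) -addrA (le_trans (ler_normD _ _))//.
  have h1 := lK1 x b; have h2 := lK2 b y.
  rewrite ax xb lexx (ltW ab)/= in h1; rewrite yc lexx (ltW bc) (ltW by_)/= in h2.
  have {}h1 := h1 isT isT; have {}h2 := h2 isT isT.
  apply: le_trans (lerD h1 h2) _; rewrite !ler0_norm; [nra|lra..].
- apply: filterS2 d1 d2; first exact: (ae_filter_ringOfSetsType mu).
  move=> t h1 h2; rewrite /= in_itv/= => /andP[at_ tc].
  have [tb|/ltW bt] := leP t b; first by apply: h1; rewrite /= in_itv/= at_.
  by apply: h2; rewrite /= in_itv/= bt.
Qed.

Lemma future_causal_concat M u v w a b c gamma delta :
  future_causal_from_to v0 M u v a b gamma ->
  future_causal_from_to v0 M v w b c delta ->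
  exists2 eta, future_causal_from_to v0 M u w a c eta &
    (curve_length a c eta = curve_length a b gamma + curve_length b c delta)%E.
Proof.
move=> [g1 ga gb] [g2 db dc].
have ab := future_curve_lt g1; have bc := future_curve_lt g2.
pose eta t := if t <= b then gamma t else delta t.
have e1 t : t <= b -> gamma t = eta t by rewrite /eta => ->.
have e2 t : b <= t -> delta t = eta t.
  rewrite /eta le_eqVlt => /orP[/eqP<-|]; first by rewrite lexx gb db.
  by rewrite ltNge => /negbTE->.
have h1 : future_curve v0 causal M `[a, b] eta.
  by apply: future_curve_eq g1 => t /andP[_]; exact: e1.
have h2 : future_curve v0 causal M `[b, c] eta.
  by apply: future_curve_eq g2 => t /andP[+ _]; exact: e2.
have h := future_curve_glue h1 h2.
exists eta; first by split; [exact: h|rewrite -e1// ltW|rewrite -e2// ltW].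
have e1' t : a < t < b -> gamma t = eta t by move=> /andP[_ /ltW]; exact: e1.
have e2' t : b < t < c -> delta t = eta t by move=> /andP[/ltW + _]; exact: e2.
rewrite (curve_length_eq e1') (curve_length_eq e2').
exact: curve_length_split h (ltW ab) (ltW bc).
Qed.

Lemma lorentz_dist_ub M u v a b gamma :
  future_causal_from_to v0 M u v a b gamma ->
  (curve_length a b gamma <= lorentz_dist v0 M u v)%E.
Proof.
move=> g; rewrite /lorentz_dist asboolT; last by exists a, b, gamma.
by apply: ereal_sup_ubound; exists a, b, gamma.
Qed.

Lemma lorentz_dist_le M u v (x : \bar R) : (0 <= x)%E ->
  (forall a b gamma, future_causal_from_to v0 M u v a b gamma ->
    (curve_length a b gamma <= x)%E) -> (lorentz_dist v0 M u v <= x)%E.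
Proof.
move=> x0 h; rewrite /lorentz_dist; case: asboolP => // _.
by apply: ge_ereal_sup => _ [a [b [gamma [g ->]]]]; exact: h.
Qed.

Lemma curve_length_ge0 a b gamma : (0 <= curve_length a b gamma)%E.
Proof. by apply: integral_ge0 => t _; rewrite lee_fin mnorm_ge0. Qed.

Lemma lorentz_dist_ge0 M u v : (0 <= lorentz_dist v0 M u v)%E.
Proof.
rewrite /lorentz_dist; case: asboolP => // -[a [b [gamma g]]].
apply: le_ereal_sup_tmp; exists (curve_length a b gamma).
  by exists a, b, gamma.
exact: curve_length_ge0.
Qed.

Lemma lorentz_dist_bound M u v : timelike v0 ->
  (lorentz_dist v0 M u v <=
    (Num.max 0 ((mnorm v0)^-1 * (mink u v0 - mink v v0)))%:E)%E.
Proof.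
move=> tv; apply: lorentz_dist_le; first by rewrite lee_fin le_max lexx.
move=> a b gamma [g <- <-]; apply: le_trans (curve_length_bound tv g) _.
by rewrite lee_fin le_max lexx orbT.
Qed.

(** A positive distance needs [mink _ v0] to decrease from the first point to the second. Hence the
    sum in [dJ] always reduces to one term. *)
Lemma lorentz_dist_asym M u v : timelike v0 ->
  lorentz_dist v0 M u v = 0%E \/ lorentz_dist v0 M v u = 0%E.
Proof.
move=> tv; have m0 : 0 < (mnorm v0)^-1 by rewrite invr_gt0 mnorm_timelike.
have h x y : mink x v0 <= mink y v0 -> lorentz_dist v0 M x y = 0%E.
  move=> xy; apply/eqP; rewrite eq_le lorentz_dist_ge0 andbT.
  apply: le_trans (lorentz_dist_bound M x y tv) _.
  by rewrite lee_fin ge_max lexx/= pmulr_rle0// subr_le0.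
by case/orP: (le_total (mink u v0) (mink v v0)) => ?; [left|right]; exact: h.
Qed.

(** It goes from [w] at [b] to [r *: w] at [b + 1]; the free start [b] lets it be joined to either
    end of a given curve. *)
Definition ray_segment (b r : R) w (t : R) : L := (1 + (r - 1) * (t - b)) *: w.

Lemma is_derive_ray_segment b r w t :
  is_derive t 1 (ray_segment b r w : R^o -> L) ((r - 1) *: w).
Proof.
have dE i : is_derive t 1 (fun t => ray_segment b r w t ord0 i) (((r - 1) *: w) ord0 i).
  have -> : (fun t => ray_segment b r w t ord0 i) =
      (cst ((1 - (r - 1) * b) * w ord0 i) : R -> R) + ((r - 1) * w ord0 i) *: id.
    apply/funext => s; rewrite /ray_segment mxE [RHS]/=.
    have -> : ((cst ((1 - (r - 1) * b) * w ord0 i) : R -> R) +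
      ((r - 1) * w ord0 i) *: id) s = (1 - (r - 1) * b) * w ord0 i +
      ((r - 1) * w ord0 i) * s by [].
    ring.
  have dz := @is_deriveZ R R R (id : R -> R) ((r - 1) * w ord0 i) t 1 _ (is_derive_id t 1).
  have := @is_deriveD R R R _ _ t 1 _ _
    (is_derive_cst ((1 - (r - 1) * b) * w ord0 i : R) t 1) dz.
  by rewrite mxE add0r [_ *: _]mulr1.
have dd : derivable (ray_segment b r w : R^o -> L) t 1.
  apply/derivable_mxP => i j; rewrite ord1.
  have := dE j => dj; exact: ex_derive.
split=> //; rewrite (derive_mx dd); apply/rowP => j; rewrite mxE.
by have [_ ->] := dE j.
Qed.

Lemma ray_segment_curve M b r w : (forall x s, M x -> 0 < s -> M (s *: x)) ->
  M w -> 1 < r -> timelike w -> future_directed v0 w ->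
  future_causal_from_to v0 M w (r *: w) b (b + 1) (ray_segment b r w) /\
  curve_length b (b + 1) (ray_segment b r w) = ((r - 1) * mnorm w)%:E.
Proof.
move=> coneM Mw r1 tw fw.
have r10 : 0 < r - 1 by rewrite subr_gt0.
have dE t : derive1 (ray_segment b r w) t = (r - 1) *: w.
  by rewrite derive1E; have [_ ->] := is_derive_ray_segment b r w t.
split; last first.
  rewrite /curve_length; under eq_integral do rewrite dE (mnormZ _ (ltW r10)).
  rewrite integral_cst//= lebesgue_measure_itv/= lte_fin ltrDl ltr01.
  by rewrite -EFinD -EFinM addrAC subrr add0r mulr1.
split; last 2 first.
- by rewrite /ray_segment subrr mulr0 addr0 scale1r.
- by rewrite /ray_segment addrAC subrr add0r mulr1 addrC subrK.
split.
- split; first exact: interval_is_interval.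
  exists (b + 2^-1); rewrite interior_itv/= in_itv/=; apply/andP; split; lra.
- move=> _ [t /= + <-]; rewrite in_itv/= => /andP[bt tb]; apply: coneM => //.
  nra.
- apply: lipschitz_bounded_locally => e; exists ((r - 1) * `|w|).
    by rewrite mulr_ge0// ltW.
  move=> x y _ _ _ _; rewrite /ray_segment -scalerBl normrZ.
  rewrite [X in `|X| * _](_ : _ = (r - 1) * (x - y)); last ring.
  by rewrite normrM gtr0_norm// mulrAC.
- apply: aeW => t _; rewrite dE; split.
  + exact: (@ex_derive _ _ _ _ _ _ _ (is_derive_ray_segment b r w t)).
  + by apply: timelike_causal; apply: timelikeZ => //; rewrite gt_eqF.
  + exact: future_directedZ.
Qed.

End Curves.

(** * Inextendibility and rescaling by exponentials *)

Section Inextendible.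
Context {R : realType} {n : nat} (v0 : 'rV[R]_n.+1).
Local Notation L := 'rV[R]_n.+1.
Local Notation mu := (@lebesgue_measure R).
Implicit Types (M : set L) (J K : set R) (gamma delta Gamma : R -> L).

(** In an extension beyond [J], the supremum [s] of [J] lies in [K], and continuity of [delta] keeps
    [Gamma] near [delta s] on a whole end of the line, because [phi] is monotone onto the line. But
    [Gamma] leaves a neighbourhood of every point of [M] at both ends. *)
Lemma escape_no_extension M Gamma J K (phi : R -> R) delta (x : R) :
  (forall m, M m -> exists2 e, 0 < e & forall t0,
    (exists2 t, t0 <= t & e <= `|Gamma t - m|) /\
    (exists2 t, t <= t0 & e <= `|Gamma t - m|)) ->
  is_interval K -> J `<=` K -> phi @` J = setT ->
  (forall k, K k -> M (delta k)) ->
  (forall k e, K k -> 0 < e -> exists2 d, 0 < d &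
    forall l, K l -> `|l - k| < d -> `|delta l - delta k| < e) ->
  {in J, delta =1 Gamma \o phi} ->
  {in J &, {homo phi : s t / s < t}} \/
    {in J &, {homo phi : s t / s < t >-> t < s}} ->
  K x -> (forall j, J j -> j < x) -> False.
Proof.
move=> esc iK JK phiJ KM cK eqJ mono Kx Jx.
have Jphi t : exists2 j, J j & phi j = t.
  by have : setT t by []; rewrite -phiJ => -[j Jj <-]; exists j.
have supJ : has_sup J.
  split; first by have [j Jj _] := Jphi 0; exists j.
  by exists x => j /Jx /ltW.
pose s := sup J.
have Js j : J j -> j <= s by move=> Jj; apply: ub_le_sup => //; case: supJ.
have sx : s <= x by apply: ge_sup; [case: supJ|move=> j /Jx /ltW].
have Ks : K s.
  have [j Jj _] := Jphi 0.
  by apply: (iK _ _ (JK _ Jj) Kx); rewrite Js.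
have [e e0 he] := esc _ (KM _ Ks).
have [d d0 hd] := cK _ _ Ks e0.
have [j0 Jj0 sj0] := sup_adherent d0 supJ.
have close j : J j -> j0 <= j -> `|Gamma (phi j) - delta s| < e.
  move=> Jj j0j; have := eqJ j (mem_set Jj); rewrite /= => <-.
  apply: hd; first exact: JK.
  by rewrite ler0_norm ?subr_le0 ?Js// opprB ltrBlDr -ltrBlDl (lt_le_trans sj0).
have [[t1 t1j et1] [t2 t2j et2]] := he (phi j0).
case: mono => mono.
- have [j Jj jt] := Jphi t1.
  have : `|Gamma t1 - delta s| < e.
    rewrite -jt; apply: close => //; rewrite leNgt; apply/negP => jj0.
    have := mono j j0 (mem_set Jj) (mem_set Jj0) jj0.
    by rewrite jt ltNge t1j.
  by rewrite ltNge et1.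
- have [j Jj jt] := Jphi t2.
  have : `|Gamma t2 - delta s| < e.
    rewrite -jt; apply: close => //; rewrite leNgt; apply/negP => jj0.
    have := mono j j0 (mem_set Jj) (mem_set Jj0) jj0.
    by rewrite jt ltNge t2j.
  by rewrite ltNge et2.
Qed.

Lemma inextendible_escape M Gamma :
  (forall m, M m -> exists2 e, 0 < e & forall t0,
    (exists2 t, t0 <= t & e <= `|Gamma t - m|) /\
    (exists2 t, t <= t0 & e <= `|Gamma t - m|)) ->
  inextendible v0 M setT Gamma.
Proof.
move=> esc [J [K [phi [delta [[iJ phiJ mono] [JK nKJ] cK eqJ]]]]].
have [iK KM contK] : [/\ is_interval K, forall k, K k -> M (delta k) &
    forall k e, K k -> 0 < e -> exists2 d, 0 < d &
    forall l, K l -> `|l - k| < d -> `|delta l - delta k| < e].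
  (* A past-directed [delta] is future-directed after a reflection, and what is needed here is
     invariant under it. *)
  case: cK => -[[iK _] KM lK _].
    split=> //; first by move=> k Kk; apply: KM; exists k.
    by move=> k e Kk; exact: locally_lipschitz_near_continuous.
  have NK k : K k -> (-%R @` K) (- k) by move=> Kk; exists k.
  have KN k : (-%R @` K) k -> K (- k) by move=> [l Kl <-]; rewrite opprK.
  split.
  - move=> x y Kx Ky z /andP[xz zy]; rewrite -(opprK z); apply: KN.
    by apply: (iK _ _ (NK _ Ky) (NK _ Kx)); rewrite !lerN2 zy.
  - move=> k Kk; apply: KM; exists (- k); first exact: NK.
    by rewrite /= opprK.
  - move=> k e Kk e0.
    have [d d0 hd] := locally_lipschitz_near_continuous lK (NK _ Kk) e0.
    exists d => // l Kl lk; have := hd _ (NK _ Kl).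
    have -> : - l - - k = - (l - k) by ring.
    by rewrite /= !opprK normrN; exact.
have [x [Kx Jx]] : exists x, K x /\ ~ J x.
  by apply: contrapT => /forallNP h; apply: nKJ => x Kx; apply: contrapT => ?; exact: (h x).
have [j0 Jj0] : exists j, J j.
  by have : setT (0 : R) by []; rewrite -phiJ => -[j Jj _]; exists j.
have [xj0|j0x] := leP x j0; last first.
  apply: (escape_no_extension esc iK JK phiJ KM contK eqJ mono Kx) => j Jj.
  rewrite ltNge; apply/negP => xj; apply: Jx; apply: (iJ _ _ Jj0 Jj).
  by rewrite (ltW j0x).
(* An extension to the left becomes one to the right when the parameter is reflected. *)
pose N (A : set R) := [set t | A (- t)].
apply: (@escape_no_extension M Gamma (N J) (N K) (phi \o -%R) (delta \o -%R) (- x)) => //.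
- move=> y z Ky Kz t /andP[yt tz]; apply: (iK _ _ Kz Ky).
  by rewrite !lerN2 yt tz.
- by move=> t; exact: JK.
- rewrite -phiJ; apply/seteqP; split=> t [j Jj <-].
    by exists (- j).
  by exists (- j); rewrite /N/= opprK.
- by move=> k; exact: KM.
- move=> k e Kk e0; have [d d0 hd] := contK _ _ Kk e0.
  exists d => // l Kl lk; apply: hd => //.
  have -> : - l - - k = - (l - k) by ring.
  by rewrite normrN.
- by move=> j; rewrite inE /N/= => Jj; apply: eqJ; rewrite inE.
- case: mono => mono; [right|left] => s t; rewrite !inE /N/= => Js Jt st;
    by apply: mono; rewrite ?inE// ltrN2.
- by rewrite /N/= opprK.
- move=> j Jj; rewrite ltrNr ltNge; apply/negP => jx; apply: Jx.
  by apply: (iJ _ _ Jj Jj0); rewrite jx.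
Qed.

(** The norm of [Gamma] tends to infinity in the future and to zero in the past, while no point of
    [M] is zero; so [Gamma] escapes from each of them. *)
Lemma exp_ends_inextendible M (a b eps : R) (u w : L) Gamma :
  0 < eps -> u != 0 -> w != 0 -> (forall m, M m -> m != 0) ->
  (forall t, t <= a -> Gamma t = expR (eps * (t - a)) *: u) ->
  (forall t, b <= t -> Gamma t = expR (eps * (t - b)) *: w) ->
  inextendible v0 M setT Gamma.
Proof.
move=> eps0 u0 w0 M0 Ga Gb; apply: inextendible_escape => m Mm.
have m0 : 0 < `|m| by rewrite normr_gt0 M0.
have {}u0 : 0 < `|u| by rewrite normr_gt0.
have {}w0 : 0 < `|w| by rewrite normr_gt0.
exists (Num.min 1 (`|m| / 2)); first by rewrite lt_min ltr01 divr_gt0.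
move=> t0; split.
(* Chosen so that [expR x >= 1 + x] yields a norm of at least [|m| + 1] from [b + X] on. *)
- pose X := (`|m| + 1) / `|w| / eps.
  pose t := Num.max t0 (b + X).
  exists t; first by rewrite le_max lexx.
  have bt : b + X <= t by rewrite le_max lexx orbT.
  have X0 : 0 <= X by rewrite !divr_ge0// ltW// addr_gt0.
  rewrite Gb; last by rewrite (le_trans _ bt)// lerDl.
  apply: (@le_trans _ _ 1); first by rewrite ge_min lexx.
  apply: le_trans (lerB_dist _ _); rewrite lerBrDl.
  rewrite normrZ ger0_norm ?expR_ge0//.
  apply: (@le_trans _ _ (eps * X * `|w|)).
    have -> : eps * X * `|w| = `|m| + 1 by rewrite /X; field; rewrite !gt_eqF.
    by rewrite addrC.
  rewrite ler_pM2r//; apply: le_trans (expR_ge1Dx _).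
  rewrite ler_wpDl// ler_pM2l//; lra.
(* Chosen so that [expR (- X) <= X^-1] brings the norm down to half of that of [m]. *)
- pose X := 2 * `|u| / `|m|.
  pose t := Num.min t0 (a - X / eps).
  exists t; first by rewrite ge_min lexx.
  have ta : t <= a - X / eps by rewrite ge_min lexx orbT.
  have X0 : 0 < X by rewrite divr_gt0// mulr_gt0.
  rewrite Ga; last by rewrite (le_trans ta)// gerBl divr_ge0// ltW.
  apply: (@le_trans _ _ (`|m| / 2)); first by rewrite ge_min lexx orbT.
  rewrite distrC; apply: le_trans (lerB_dist _ _).
  suff : `|expR (eps * (t - a)) *: u| <= `|m| / 2 by lra.
  rewrite normrZ ger0_norm ?expR_ge0//.
  have h1 : expR (eps * (t - a)) <= expR (- X).
    rewrite ler_expR -ler_pdivlMl// mulrC; lra.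
  have h2 : expR (- X) <= X^-1.
    rewrite expRN lef_pV2 ?posrE ?expR_gt0//.
    by apply: le_trans (expR_ge1Dx _); rewrite lerDr.
  apply: le_trans (ler_wpM2r (ltW u0) (le_trans h1 h2)) _.
  have -> : X^-1 * `|u| = `|m| / 2 by rewrite /X; field; rewrite !gt_eqF.
  by [].
Qed.

Lemma expR_lipschitz (c x y : R) : x <= c -> y <= c ->
  `|expR x - expR y| <= expR c * `|x - y|.
Proof.
wlog xy : x y / x <= y.
  by move=> h xc yc; case/orP: (le_total x y) => [/h|/h]; [|rewrite distrC (distrC x)]; exact.
move=> xc yc; rewrite !ler0_norm ?subr_le0 ?ler_expR// !opprB.
apply: (@le_trans _ _ (expR y * (y - x))); last first.
  by rewrite ler_wpM2r ?subr_ge0// ler_expR.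
have -> : expR y - expR x = expR y * (1 - expR (x - y)).
  by rewrite mulrBr mulr1 -expRD (addrC y) subrK.
rewrite ler_wpM2l ?expR_ge0//.
have := expR_ge1Dx (x - y); lra.
Qed.

(** By the product rule the derivative is [expR (phi t)] times [vel t + psi t *: gamma t], and a
    positive factor preserves both the causal type and the cone. *)
Lemma exp_timelike_curve M (phi psi : R -> R) gamma (vel : R -> L) (k1 k2 : R) :
  (forall x s, M x -> 0 < s -> M (s *: x)) ->
  (forall t, M (gamma t)) ->
  (forall s t, `|phi s - phi t| <= k1 * `|s - t|) ->
  (forall s t, `|gamma s - gamma t| <= k2 * `|s - t|) ->
  {ae mu, forall t : R, is_derive t 1 phi (psi t)} ->
  {ae mu, forall t : R, is_derive t 1 (gamma : R^o -> L) (vel t)} ->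
  {ae mu, forall t : R, timelike (vel t + psi t *: gamma t) /\
    future_directed v0 (vel t + psi t *: gamma t)} ->
  timelike_curve v0 M setT (fun t => expR (phi t) *: gamma t).
Proof.
move=> coneM gM lphi lgam dphi dgam tl; left; split.
- split; first by move=> x y _ _ z _.
  by exists 0; rewrite interiorT.
- by move=> _ [t _ <-]; apply: coneM => //; exact: expR_gt0.
- apply: lipschitz_bounded_locally => c.
  pose B1 := `|phi 0| + k1 * `|c|; pose B2 := `|gamma 0| + k2 * `|c|.
  have k10 : 0 <= k1.
    by have := lphi 1 0; rewrite subr0 normr1 mulr1; exact: le_trans.
  have k20 : 0 <= k2.
    by have := lgam 1 0; rewrite subr0 normr1 mulr1; exact: le_trans.
  have b1 t : `|t| <= c -> phi t <= B1.
    move=> tc; rewrite (le_trans (ler_norm _))// -(subrK (phi 0) (phi t)).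
    rewrite (le_trans (ler_normD _ _))// addrC lerD2l (le_trans (lphi _ _))//.
    by rewrite subr0 ler_wpM2l// (le_trans tc)// ler_norm.
  have b2 t : `|t| <= c -> `|gamma t| <= B2.
    move=> tc; rewrite -(subrK (gamma 0) (gamma t)).
    rewrite (le_trans (ler_normD _ _))// addrC lerD2l (le_trans (lgam _ _))//.
    by rewrite subr0 ler_wpM2l// (le_trans tc)// ler_norm.
  have B20 : 0 <= B2 by rewrite addr_ge0// mulr_ge0.
  exists (expR B1 * k2 + expR B1 * k1 * B2).
    by rewrite addr_ge0 ?mulr_ge0 ?expR_ge0.
  move=> x y _ _ xc yc.
  rewrite (_ : _ - _ = expR (phi x) *: (gamma x - gamma y) +
    (expR (phi x) - expR (phi y)) *: gamma y); last first.
    by rewrite scalerBr scalerBl addrA subrK.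
  rewrite (le_trans (ler_normD _ _))// mulrDl lerD//.
    rewrite normrZ ger0_norm ?expR_ge0// -mulrA ler_pM ?expR_ge0//.
    by rewrite ler_expR b1.
  rewrite normrZ [leRHS]mulrAC ler_pM// ?b2//.
  rewrite (le_trans (expR_lipschitz (b1 _ xc) (b1 _ yc)))// -mulrA.
  by rewrite ler_wpM2l ?expR_ge0.
- apply: filterS3 dphi dgam tl; first exact: (ae_filter_ringOfSetsType mu).
  move=> t dp dg [tt ft] _.
  have dE i : is_derive t 1 (fun t => (expR (phi t) *: gamma t) ord0 i)
      ((expR (phi t) *: (vel t + psi t *: gamma t)) ord0 i).
    have de := @is_derive1_comp _ expR phi t _ _ (is_derive_expR (phi t)) dp.
    have := @is_deriveM _ _ _ _ _ _ _ _ de (is_derive_coord i dg).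
    have -> : (expR \o phi) * (fun t => gamma t ord0 i) =
        fun t => (expR (phi t) *: gamma t) ord0 i.
      by apply/funext => s; rewrite mxE.
    congr (is_derive _ _ _ _); rewrite !mxE /=.
    by rewrite -![_ *: _ : R]/(_ * _); ring.
  have dd : derivable ((fun t => expR (phi t) *: gamma t) : R^o -> L) t 1.
    by apply/derivable_mxP => i j; rewrite ord1; have := dE j => -[].
  have E : derive1 (fun t => expR (phi t) *: gamma t) t =
      expR (phi t) *: (vel t + psi t *: gamma t).
    rewrite derive1E (derive_mx dd); apply/rowP => j.
    by have [_ <-] := dE j; rewrite mxE.
  rewrite E; split; first exact: dd.
    by apply: timelikeZ => //; rewrite gt_eqF ?expR_gt0.
  by apply: future_directedZ => //; exact: expR_gt0.
Qed.

End Inextendible.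

(** * Cauchy hypersurfaces, rays, and causal curves of length zero *)

Section ConicalSpacetime.
Context {R : realType} {n : nat} (v0 : 'rV[R]_n.+1).
Local Notation L := 'rV[R]_n.+1.
Local Notation mu := (@lebesgue_measure R).
Implicit Types (M S : set L) (u v p : L) (a b r s t : R) (gamma : R -> L).

Lemma cone_scale M : conical_spacetime v0 M ->
  forall x s, M x -> 0 < s -> M (s *: x).
Proof.
move=> [D _ ->] x s [r [w [r0 Ow ->]]] s0.
by exists (s * r), w; split; rewrite ?mulr_gt0// scalerA.
Qed.

Lemma cone_future M : conical_spacetime v0 M ->
  forall x, M x -> timelike x /\ future_directed v0 x.
Proof.
move=> [D [_ OH _] ->] _ [r [w [r0 /OH[[tw fw] _] ->]]].
by split; [apply: timelikeZ => //; rewrite gt_eqF|exact: future_directedZ].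
Qed.

Lemma cone_nonempty M : conical_spacetime v0 M -> M !=set0.
Proof.
by move=> [D [[w Ow] _ _] ->]; exists w, 1, w; rewrite scale1r.
Qed.

Lemma cone_neq0 M : conical_spacetime v0 M -> forall x, M x -> x != 0.
Proof.
move=> cM x /(cone_future cM)[tx _]; apply/eqP => x0.
by move: tx; rewrite /timelike x0 mink0l ltxx.
Qed.

(** The parametrization [expR t *: p] covers the whole open ray and escapes at both ends; [ln] turns
    uniqueness of the parameter into uniqueness of the factor. *)
Lemma Cauchy_ray M S p : conical_spacetime v0 M ->
  Cauchy_hypersurface v0 M S -> M p ->
  exists2 s, 0 < s /\ S (s *: p) & forall r, 0 < r -> S (r *: p) -> r = s.
Proof.
move=> cM [_ CS] Mp; have [tp fp] := cone_future cM Mp.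
pose Gamma (t : R) := expR t *: p.
have tG : timelike_curve v0 M setT Gamma.
  apply: (@exp_timelike_curve _ _ _ M id (cst 1) (cst p) (cst 0) 1 0) => //.
  - exact: cone_scale.
  - by move=> s t; rewrite mul1r.
  - by move=> s t; rewrite /= subrr normr0 mul0r.
  - by apply: aeW => t; exact: is_derive_id.
  - by apply: aeW => t; exact: is_derive_cst.
  - by apply: aeW => t; rewrite /= add0r scale1r.
have iG : inextendible v0 M setT Gamma.
  apply: (@exp_ends_inextendible _ _ _ M 0 0 1 p p) => //; try exact: cone_neq0 Mp.
  - exact: cone_neq0.
  - by move=> t _; rewrite subr0 mul1r.
  - by move=> t _; rewrite subr0 mul1r.
have [t [[_ St] tu]] := CS _ _ tG iG.
exists (expR t); first by rewrite expR_gt0.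
move=> r r0 Sr; have := tu (ln r); rewrite /Gamma lnK ?posrE// => ->//.
by rewrite lnK ?posrE.
Qed.

(** The curve is multiplied by [expR (phi t)] with [phi' = eps - k]. Here [k] is a multiple of
    [- mink (vel t) (vel t)], small enough to keep the curve causal, and the constant [eps > 0],
    which makes it timelike, is the mean of [k], so that [phi] vanishes at [a] and [b]. *)
Lemma Cauchy_length0 M S u v a b gamma : timelike v0 -> conical_spacetime v0 M ->
  Cauchy_hypersurface v0 M S -> S u -> S v ->
  future_causal_from_to v0 M u v a b gamma ->
  curve_length a b gamma = 0%E.
Proof.
move=> tv0 cM CS Su Sv [fg ga gb].
have [K [vel [V ae]]] := future_curve_velocity fg.
have ab := vel_lt V.
pose g := gamma \o clamp a b.
have gM t : M (g t) by apply: (future_curve_in fg); apply: clamp_in; exact: ltW.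
have K0 : 0 <= K := le_trans (normr_ge0 _) (vel_bound V 0).
(* A bound for [- mink (vel t) (g t)]; the added [1] makes it positive. *)
pose C := n.+1%:R * (K * (`|gamma a| + K * (b - a))) + 1.
have gB t : `|g t| <= `|gamma a| + K * (b - a).
  rewrite -(subrK (gamma a) (g t)) (le_trans (ler_normD _ _))// addrC lerD2l.
  have := vel_lip V (clamp a b t) a; rewrite /= (clamp_id (clamp_in t (ltW ab))).
  rewrite (@clamp_id _ a b a) ?lexx ?(ltW ab)//.
  move=> /le_trans; apply; rewrite ler_wpM2l//.
  by have /andP[? ?] := clamp_in t (ltW ab); rewrite ger0_norm; lra.
have C0 : 0 < C by rewrite ltr_wpDl// !mulr_ge0// addr_ge0// mulr_ge0// subr_ge0 ltW.
have velgC t : - mink (vel t) (g t) <= C.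
  apply: le_trans (ler_norm _) _; rewrite normrN (le_trans (mink_bound _ _))//.
  rewrite ler_wpDr// ler_wpM2l// ler_pM//; exact: vel_bound V _.
have velvel t : mink (vel t) (vel t) <= 0.
  case: (vel_future V t) => [->|[ct _]]; first by rewrite mink0l.
  by rewrite leNgt; exact/negP.
pose k t := - mink (vel t) (vel t) / (2 * C).
have k0 t : 0 <= k t by rewrite divr_ge0 ?oppr_ge0 ?mulr_ge0// ltW.
have kC t : 2 * k t * C = - mink (vel t) (vel t).
  by rewrite /k; field; rewrite gt_eqF.
pose kmax := n.+1%:R * (K * K) / (2 * C).
have kmaxE t : k t <= kmax.
  rewrite ler_wpM2r ?invr_ge0 ?mulr_ge0 ?(ltW C0)//.
  apply: le_trans (ler_norm _) _; rewrite normrN (le_trans (mink_bound _ _))//.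
  by rewrite ler_wpM2l// ler_pM//; exact: vel_bound V _.
have kout t : ~ (a < t < b) -> k t = 0.
  by move=> /(vel_out V) vt; rewrite /k vt mink0l oppr0 mul0r.
have mk : measurable_fun setT k.
  apply: measurable_funM => //; apply: measurable_funN.
  by apply: measurable_mink; exact: vel_meas V.
have ikab : mu.-integrable `[a, b] (EFin \o k).
  apply: (@integrable_segment _ _ _ _ kmax); first exact: measurable_funTS.
  by move=> t _; rewrite ger0_norm.
have kpatch (D : set R) : `]a, b[ `<=` D -> k \_ D = k.
  move=> abD; apply/funext => t; rewrite patchE; case: ifPn => // tD.
  rewrite kout// => tab; move/negP : tD; apply; apply/mem_set/abD.
  by rewrite /= in_itv.
have ik : mu.-integrable setT (EFin \o k).
  have : mu.-integrable setT ((EFin \o k) \_ `[a, b]).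
    exact: (proj1 (@integrable_mkcond _ _ _ mu _ (EFin \o k) (measurable_itv `[a, b])) ikab).
  rewrite restrict_EFin kpatch//.
  exact: subset_itv_oo_cc.
have iky y : mu.-integrable `]-oo, y] (EFin \o k) by exact: integrableS ik.
pose tot := (\int[mu]_(t in `[a, b]) k t)%R.
(* Since [k] vanishes outside []a, b[], this primitive on the whole line is [0] before [a] and [tot]
   after [b]. *)
pose G x := (\int[mu]_(t in `]-oo, x]) k t)%R.
have Ga x : x <= a -> G x = 0.
  move=> xa; rewrite /G Rintegral_mkcond (_ : k \_ _ = cst 0).
    by rewrite /Rintegral integral0.
  apply/funext => t; rewrite patchE; case: ifPn => // /set_mem/=.
  rewrite in_itv/= => tx; rewrite kout// => /andP[at_ _].
  by have := le_trans tx xa; rewrite leNgt at_.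
have Gb x : b <= x -> G x = tot.
  move=> bx; rewrite /G /tot Rintegral_mkcond [RHS]Rintegral_mkcond !kpatch//.
    exact: subset_itv_oo_cc.
  move=> t /=; rewrite !in_itv/= => /andP[_ /ltW tb]; exact: le_trans bx.
have lG s t : `|G s - G t| <= kmax * `|s - t|.
  wlog ts : s t / t <= s.
    move=> h; case/orP: (le_total t s) => [|st]; first exact: h.
    by rewrite distrC (distrC s); exact: h.
  rewrite Rintegral_itvB// ger0_norm; last by apply: Rintegral_ge0.
  have mts : (mu `]t, s] < +oo)%E.
    by rewrite /= lebesgue_measure_itv; case: ifP => _; rewrite /= ?ltry// -EFinD ltry.
  have : \int[mu]_(x in `]t, s]) k x <= \int[mu]_(x in `]t, s]) cst kmax x.
    apply: le_Rintegral => //.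
    - exact: integrableS ik.
    - apply: measurable_bounded_integrable => //.
      exists kmax; split; first exact: num_real.
      by move=> x /ltW hx y _ /=; rewrite ger0_norm// (le_trans (k0 0)).
  move=> h; apply: (le_trans h).
  rewrite Rintegral_cst//= lebesgue_measure_itv/= lte_fin (ger0_norm (_ : 0 <= s - t)) ?subr_ge0//.
  case: ltP => _ //=; first by rewrite mulr0 mulr_ge0 ?subr_ge0// (le_trans (k0 0)).
have dG : {ae mu, forall t : R, derivable G t 1 /\ derive1 G t = k t}.
  apply: FTC1Ny => //.
  by apply: open_integrable_locally => //; exact: openT.
have [//|L0] := eqVneq (curve_length a b gamma) 0%E; exfalso.
(* If [k] had integral zero, [mink (vel t) (vel t)] would vanish almost everywhere on the segment,
   and so would the length. *)
have tot0 : 0 < tot.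
  rewrite lt_neqAle Rintegral_ge0// andbT eq_sym; apply: contra_neq L0 => tot0.
  have : (\int[mu]_(t in `[a, b]) `|(EFin \o k) t| = 0)%E.
    under eq_integral do rewrite /= ger0_norm//.
    have -> : (\int[mu]_(t in `[a, b]) (k t)%:E = tot%:E)%E.
      by rewrite /tot /Rintegral fineK//; exact: integrable_fin_num ikab.
    by rewrite tot0.
  have mkE : measurable_fun `[a, b] (EFin \o k).
    by apply/measurable_EFinP; exact: measurable_funTS.
  move/(ae_eq_integral_abs mu (measurable_itv _) mkE) => kae.
  rewrite /curve_length (integral_mnorm_velocity _ ae)//.
  rewrite (@ge0_ae_eq_integral _ _ _ mu _ _ (cst 0%E)) ?integral0//.
  - apply/measurable_EFinP; apply: measurable_funTS.
    exact: measurable_mnorm (vel_meas V).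
  - by move=> t _; rewrite lee_fin mnorm_ge0.
  - move: kae; apply: filterS.
    move=> t h It; have [kt] := h It; congr EFin.
    have := kC t; rewrite kt mulr0 mul0r => /esym/eqP; rewrite oppr_eq0 => /eqP vv.
    by rewrite /mnorm vv normr0 sqrtr0.
pose eps := tot / (b - a).
have eps0 : 0 < eps by rewrite divr_gt0// subr_gt0.
have epsE : eps * (b - a) = tot by rewrite /eps mulfVK// gt_eqF// subr_gt0.
pose phi t := eps * (t - a) - G t.
pose Gamma t := expR (phi t) *: g t.
have Gal t : t <= a -> Gamma t = expR (eps * (t - a)) *: u.
  by move=> ta; rewrite /Gamma /phi Ga// subr0 /g/= clamp_left ?(ltW ab)// ga.
have Gbr t : b <= t -> Gamma t = expR (eps * (t - b)) *: v.
  move=> bt; rewrite /Gamma /phi Gb// /g/= clamp_right ?(ltW ab)// gb -epsE.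
  by congr (expR _ *: _); ring.
have tG : timelike_curve v0 M setT Gamma.
  apply: (@exp_timelike_curve _ _ _ M phi (fun t => eps - k t) g vel (eps + kmax) K).
  - exact: cone_scale.
  - exact: gM.
  - move=> s t; rewrite (_ : phi s - phi t = eps * (s - t) + (G t - G s)); last first.
      by rewrite /phi; ring.
    rewrite (le_trans (ler_normD _ _))// mulrDl lerD//.
      by rewrite normrM gtr0_norm.
    by rewrite distrC.
  - exact: vel_lip V.
  - apply: filterS dG; first exact: (ae_filter_ringOfSetsType mu).
    move=> t [dGt GE].
    have dGt' : is_derive t 1 G (k t) by split; [exact: dGt|rewrite -GE derive1E].
    have did : is_derive t 1 (fun t : R => t - a) (1 : R).
      have := @is_deriveB R R R _ _ t 1 _ _ (is_derive_id t 1) (is_derive_cst a t 1).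
      by rewrite subr0.
    have dz := @is_deriveZ R R R _ eps t 1 _ did.
    have := @is_deriveB R R R _ _ t 1 _ _ dz dGt'.
    by rewrite [_ *: 1]mulr1.
  - exact: vel_derive V.
  - apply: filterS (vel_ae_future V); first exact: (ae_filter_ringOfSetsType mu).
    move=> t ht; have [tg fg'] := cone_future cM (gM t).
    have [tab|tab] := pselect (a < t < b); last first.
      rewrite (vel_out V tab) (kout _ tab) add0r subr0; split.
        by apply: timelikeZ => //; rewrite gt_eqF.
      exact: future_directedZ.
    (* By the choice of [k] its contribution is at most [- mink (vel t) (vel t)], so what remains is
       at most [2 * eps * mink (vel t) (g t) < 0]. *)
    have [ct ft] := ht tab; apply: timelike_future_addZ => //.
    have B := future_mink_lt0 tv0 tg fg' ct ft.
    have h1 := kC t; have h2 := velgC t; have h3 := k0 t.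
    have h4 : 2 * k t * (- mink (vel t) (g t)) <= 2 * k t * C.
      by rewrite ler_wpM2l// mulr_ge0.
    have h5 : eps * mink (vel t) (g t) < 0 by rewrite pmulr_rlt0.
    lra.
have MS := CS.1.
have iG : inextendible v0 M setT Gamma.
  apply: (exp_ends_inextendible eps0 _ _ (cone_neq0 cM) Gal Gbr).
    by apply: (cone_neq0 cM); exact: MS.
  by apply: (cone_neq0 cM); exact: MS.
(* [Gamma] passes through [u] at [a] and through [v] at [b], both in [S], against uniqueness. *)
have [t [_ tu]] := CS.2 _ _ tG iG.
have ta : t = a by apply: tu; rewrite Gal// subrr mulr0 expR0 scale1r.
have tb : t = b by apply: tu; rewrite Gbr// subrr mulr0 expR0 scale1r.
by move: ab; rewrite -ta -tb ltxx.
Qed.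

End ConicalSpacetime.

(** * Curves crossing a compact Cauchy hypersurface *)

Section Crossing.
Context {R : realType} {n : nat} (v0 : 'rV[R]_n.+1).
Local Notation L := 'rV[R]_n.+1.
Implicit Types (M S : set L) (u v p : L) (a b r s t : R) (g gamma : R -> L).

Lemma lipschitz_coord_continuous (K : R) g i :
  (forall s t, `|g s - g t| <= K * `|s - t|) ->
  continuous (fun t => g t ord0 i).
Proof.
move=> lg; apply: (@lipschitz_continuous _ _ K) => s t.
by apply: le_trans (lg s t); have := coord_le_norm (g s - g t) i; rewrite !mxE.
Qed.

(* For [e = 1] the point of [S] on the ray of [g t] lies above [g t], for [e = -1]
   below. The set is closed as the projection of a compact set. *)
Lemma ray_side_closed M S (K a b e : R) g : timelike v0 ->
  conical_spacetime v0 M -> S `<=` M -> compact S -> (forall t, M (g t)) ->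
  (forall s t, `|g s - g t| <= K * `|s - t|) ->
  closed [set t | a <= t <= b /\ exists2 s, 0 < s /\ S (s *: g t) & 0 <= e * (s - 1)].
Proof.
move=> tv0 cM SM cS gM lg.
(* The equations say that [x.2] is proportional to [g x.1]. If the factor is [s], the inequality is
   [0 <= e * (s - 1)] times the square of the time coordinate of [g x.1]. This form is visibly
   closed. *)
pose F := [set x : R * L | (forall i, x.2 ord0 i * g x.1 ord0 ord0 -
    x.2 ord0 ord0 * g x.1 ord0 i = 0) /\
    0 <= e * (x.2 ord0 ord0 * g x.1 ord0 ord0 - g x.1 ord0 ord0 ^+ 2)].
have cg i : continuous (fun x : R * L => g x.1 ord0 i).
  move=> x; apply: (@cvg_comp _ _ _ fst (fun t => g t ord0 i)); first exact: cvg_fst.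
  exact: lipschitz_coord_continuous lg _.
have cp i : continuous (fun x : R * L => x.2 ord0 i).
  move=> x; apply: (@cvg_comp _ _ _ snd (fun p : L => p ord0 i)); first exact: cvg_snd.
  exact: coord_continuous.
have cF : closed F.
  have -> : F = (\bigcap_(i in setT) ((fun x : R * L => x.2 ord0 i * g x.1 ord0 ord0 -
    x.2 ord0 ord0 * g x.1 ord0 i) @^-1` [set 0])) `&`
    ((fun x : R * L => e * (x.2 ord0 ord0 * g x.1 ord0 ord0 - g x.1 ord0 ord0 ^+ 2))
      @^-1` [set y | 0 <= y]).
    apply/seteqP; split=> x /= [h1 h2]; split=> // i; first by move=> _; exact: h1.
    exact: h1.
  apply: closedI.
    apply: closed_bigI => i _; apply: preimage_closed; last exact: closed_eq.
    move=> x _; apply: cvgB; apply: cvgM; by [exact: cp|exact: cg].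
  apply: preimage_closed; last exact: closed_ge.
  move=> x _; apply: cvgM; first exact: cvg_cst.
  apply: cvgB; first by apply: cvgM; [exact: cp|exact: cg].
  by apply: cvgM; exact: cg.
have cC : compact ((`[a, b]%classic `*` S) `&` F).
  apply: compact_closedI => //; apply: compact_setX => //.
  exact: segment_compact.
have cI : compact (fst @` ((`[a, b]%classic `*` S) `&` F)).
  apply: continuous_compact => //; apply: continuous_subspaceT => x.
  exact: cvg_fst.
suff -> : [set t | a <= t <= b /\ exists2 s, 0 < s /\ S (s *: g t) & 0 <= e * (s - 1)] =
    fst @` ((`[a, b]%classic `*` S) `&` F).
  by apply: compact_closed => //; exact: Rhausdorff.
apply/seteqP; split.
- move=> t [tab [s [s0 Ss] es]]; exists (t, s *: g t) => //; split; first by split.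
  split=> [i|] /=; first by rewrite !mxE; ring.
  rewrite !mxE (_ : e * _ = e * (s - 1) * g t ord0 ord0 ^+ 2); last ring.
  by rewrite mulr_ge0// sqr_ge0.
- move=> _ [[t p] [[/= + Sp] [Fp ep]] <-]; rewrite in_itv/= => tab; split=> //.
  have [tg fg] := cone_future cM (gM t).
  have [tp fp] := cone_future cM (SM _ Sp).
  (* Two future-directed timelike vectors have time coordinates of the same sign, both nonzero; so
     the factor can be recovered as their quotient and is positive. *)
  have := future_mink_lt0 tv0 tg fg (timelike_causal tp) fp.
  rewrite (mink_lt0 tg (timelike_causal tp)) => pg0.
  have g0 : g t ord0 ord0 != 0 by apply/eqP => g0; rewrite g0 mulr0 ltxx in pg0.
  have g2 : 0 < g t ord0 ord0 ^+ 2 by rewrite exprn_even_gt0//= g0 orbT.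
  exists (p ord0 ord0 / g t ord0 ord0).
    split.
      rewrite (_ : _ / _ = p ord0 ord0 * g t ord0 ord0 / g t ord0 ord0 ^+ 2).
        exact: divr_gt0.
      by field.
    rewrite (_ : _ *: _ = p)//; apply/rowP => i; rewrite mxE.
    by have := Fp i => /eqP; rewrite subr_eq0 => /eqP Fi; rewrite mulrAC -Fi mulfK.
  rewrite (_ : e * _ = e * (p ord0 ord0 * g t ord0 ord0 - g t ord0 ord0 ^+ 2) /
    g t ord0 ord0 ^+ 2); last by field.
  by rewrite divr_ge0// ltW.
Qed.

(** The closed sets [A 1] and [A (-1)] cover the segment and contain [a] and [b] respectively. By
    connectedness they meet, and there the unique factor is both at least and at most [1]. *)
Lemma Cauchy_crossing M S u v a b gamma (s r : R) : timelike v0 ->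
  conical_spacetime v0 M -> Cauchy_hypersurface v0 M S -> compact S ->
  future_causal_from_to v0 M u v a b gamma ->
  1 <= s -> S (s *: u) -> 0 < r -> r <= 1 -> S (r *: v) ->
  exists2 t, a <= t <= b & S (gamma t).
Proof.
move=> tv0 cM CS cS [fg ga gb] s1 Ssu r0 r1 Srv.
have ab := future_curve_lt fg.
have [K [vel [V _]]] := future_curve_velocity fg.
pose g := gamma \o clamp a b.
have gM t : M (g t) by apply: (future_curve_in fg); apply: clamp_in; exact: ltW.
have gE t : a <= t <= b -> g t = gamma t by move=> tab; rewrite /g/= clamp_id.
pose A e := [set t | a <= t <= b /\
  exists2 s, 0 < s /\ S (s *: g t) & 0 <= e * (s - 1)].
have cA e : closed (A e).
  exact: ray_side_closed tv0 cM CS.1 cS gM (vel_lip V).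
have Aa : A 1 a.
  split; first by rewrite lexx ltW.
  exists s; last by rewrite mul1r subr_ge0.
  by rewrite gE ?lexx ?(ltW ab)// ga; split=> //; exact: lt_le_trans s1.
have Ab : A (-1) b.
  split; first by rewrite lexx ltW.
  exists r; last by rewrite mulN1r opprB subr_ge0.
  by rewrite gE ?lexx ?(ltW ab)// gb.
have cover t : a <= t <= b -> A 1 t \/ A (-1) t.
  move=> tab; have [q [q0 Sq] _] := Cauchy_ray cM CS (gM t).
  case/orP: (le_total 1 q) => q1; [left|right]; split=> //; exists q => //.
    by rewrite mul1r subr_ge0.
  by rewrite mulN1r opprB subr_ge0.
have [t [[tab [q [q0 Sq] q1]] [_ [q' [q'0 Sq'] q'1]]]] : (A 1 `&` A (-1)) !=set0.
  apply: contrapT => /set0P/negP; rewrite negbK => /eqP A0.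
  have cI : connected `[a, b]%classic by exact: segment_connected.
  have Asub : A 1 `<=` `[a, b] by move=> t [tab _]; rewrite /= in_itv.
  have AE : A 1 = `[a, b]%classic.
    (* If the two sets were disjoint, [A 1] would be relatively open as well as closed, hence the
       whole segment, including [b]. *)
    apply: cI; first by exists a.
      exists (~` A (-1)); first exact/closed_openC.
      apply/seteqP; split=> t.
        move=> At; split; first exact: Asub.
        by move=> At'; have : (A 1 `&` A (-1)) t by []; rewrite A0.
      by move=> [/= tab At]; rewrite in_itv/= in tab; have [] := cover t tab.
    exists (A 1) => //; apply/seteqP; split=> t; last by case.
    by move=> At; split => //; exact: Asub.
  have : (A 1 `&` A (-1)) b.
    by split=> //; rewrite AE /= in_itv/= lexx ltW.
  by rewrite A0.
exists t => //; rewrite -gE//.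
have [q2 _ qu] := Cauchy_ray cM CS (gM t).
have qq' : q = q' by rewrite (qu q)// (qu q').
rewrite mul1r subr_ge0 in q1; rewrite mulN1r opprB subr_ge0 -qq' in q'1.
have qE : q = 1 by apply/eqP; rewrite eq_le q1 q'1.
by rewrite qE scale1r in Sq.
Qed.

End Crossing.

(** * The metric properties of [dJ] *)

Section CauchyMetric.
Context {R : realType} {n : nat} (v0 : 'rV[R]_n.+1).
Local Notation L := 'rV[R]_n.+1.
Implicit Types (M S : set L) (u v p : L).

Lemma dJ_ub M S1 S2 u v : S1 u -> S2 v ->
  (lorentz_dist v0 M u v + lorentz_dist v0 M v u <= dJ v0 M S1 S2)%E.
Proof. by move=> Su Sv; apply: ereal_sup_ubound; exists (u, v). Qed.

Lemma dJ_ub1 M S1 S2 u v : S1 u -> S2 v -> (lorentz_dist v0 M u v <= dJ v0 M S1 S2)%E.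
Proof.
move=> Su Sv; apply: le_trans (dJ_ub M Su Sv).
by rewrite leeDl// lorentz_dist_ge0.
Qed.

Lemma dJ_le M S1 S2 (x : \bar R) :
  (forall u v, S1 u -> S2 v ->
    (lorentz_dist v0 M u v + lorentz_dist v0 M v u <= x)%E) ->
  (dJ v0 M S1 S2 <= x)%E.
Proof. by move=> h; apply: ge_ereal_sup => _ [[u v] [/= Su Sv] <-]; exact: h. Qed.

Lemma dJC M S1 S2 : dJ v0 M S1 S2 = dJ v0 M S2 S1.
Proof.
by apply/eqP; rewrite eq_le; apply/andP; split; apply: dJ_le => u v Su Sv;
  rewrite addeC; exact: dJ_ub.
Qed.

Lemma Cauchy_nonempty M S : conical_spacetime v0 M ->
  Cauchy_hypersurface v0 M S -> S !=set0.
Proof.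
move=> cM CS; have [p Mp] := cone_nonempty cM.
by have [s [_ Ss] _] := Cauchy_ray cM CS Mp; exists (s *: p).
Qed.

Lemma dJ_ge0 M S1 S2 : conical_spacetime v0 M ->
  Cauchy_hypersurface v0 M S1 -> Cauchy_hypersurface v0 M S2 ->
  (0 <= dJ v0 M S1 S2)%E.
Proof.
move=> cM /(Cauchy_nonempty cM)[u Su] /(Cauchy_nonempty cM)[v Sv].
by apply: le_trans (dJ_ub1 M Su Sv); exact: lorentz_dist_ge0.
Qed.

Lemma compact_mink_bounded S : compact S ->
  exists C, forall u, S u -> `|mink u v0| <= C.
Proof.
move=> /compact_bounded[K [_ hK]]; exists (n.+1%:R * ((`|K| + 1) * `|v0|)) => u Su.
apply: le_trans (mink_bound _ _) _; rewrite ler_wpM2l// ler_wpM2r//.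
by apply: hK => //; rewrite (le_lt_trans (ler_norm K))// ltrDl.
Qed.

Lemma dJ_lty M S1 S2 : timelike v0 -> compact S1 -> compact S2 ->
  (dJ v0 M S1 S2 < +oo)%E.
Proof.
move=> tv0 /compact_mink_bounded[C1 hC1] /compact_mink_bounded[C2 hC2].
have m0 : 0 < (mnorm v0)^-1 by rewrite invr_gt0 mnorm_timelike.
suff : (dJ v0 M S1 S2 <= ((mnorm v0)^-1 * (C1 + C2) + (mnorm v0)^-1 * (C1 + C2))%:E)%E.
  by move=> /le_lt_trans; apply; rewrite ltry.
apply: dJ_le => u v Su Sv; rewrite EFinD.
have h1 := hC1 _ Su; have h2 := hC2 _ Sv.
have C120 : 0 <= C1 + C2.
  by rewrite addr_ge0// ?(le_trans _ h1)// (le_trans _ h2).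
have h x y : `|mink x v0| + `|mink y v0| <= C1 + C2 ->
    (lorentz_dist v0 M x y <= ((mnorm v0)^-1 * (C1 + C2))%:E)%E.
  move=> xy; apply: le_trans (lorentz_dist_bound M x y tv0) _.
  rewrite lee_fin ge_max mulr_ge0 ?(ltW m0)//= ler_pM2l//.
  by rewrite (le_trans (ler_norm _))// (le_trans (ler_normB _ _)).
have h12 := lerD h1 h2; have h21 := h12; rewrite addrC in h21.
exact: leeD (h _ _ h12) (h _ _ h21).
Qed.

Lemma dJ_self M S : timelike v0 -> conical_spacetime v0 M ->
  Cauchy_hypersurface v0 M S -> dJ v0 M S S = 0%E.
Proof.
move=> tv0 cM CS; apply/eqP; rewrite eq_le dJ_ge0// andbT.
have h u v : S u -> S v -> (lorentz_dist v0 M u v <= 0)%E.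
  move=> Su Sv; apply: lorentz_dist_le => // a b gamma fg.
  by rewrite (Cauchy_length0 tv0 cM CS Su Sv fg).
by apply: dJ_le => u v Su Sv; rewrite -[leRHS]adde0 leeD// h.
Qed.

Lemma lorentz_dist_ray_gt0 M u r : conical_spacetime v0 M -> M u -> 1 < r ->
  (0 < lorentz_dist v0 M u (r *: u))%E.
Proof.
move=> cM Mu r1; have [tu fu] := cone_future cM Mu.
have [fs ls] := ray_segment_curve 0 (cone_scale cM) Mu r1 tu fu.
apply: lt_le_trans (lorentz_dist_ub fs); rewrite ls lte_fin.
by rewrite mulr_gt0 ?subr_gt0// mnorm_timelike.
Qed.

(** If [S2] met the ray of [u] at [s *: u] with [s != 1], the segment of the ray between the two
    points would give a positive distance in one direction. *)
Lemma dJ_eq0_subset M S1 S2 : conical_spacetime v0 M ->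
  Cauchy_hypersurface v0 M S1 -> Cauchy_hypersurface v0 M S2 ->
  dJ v0 M S1 S2 = 0%E -> S1 `<=` S2.
Proof.
move=> cM C1 C2 d0 u Su; have Mu := C1.1 _ Su.
have [s [s0 Ss] _] := Cauchy_ray cM C2 Mu.
have [s1|s1|s1] := ltgtP s 1; last by rewrite s1 scale1r in Ss.
- have := @lorentz_dist_ray_gt0 M (s *: u) s^-1 cM (cone_scale cM Mu s0).
  rewrite scalerA mulVf ?gt_eqF// scale1r invf_gt1// => /(_ s1).
  by rewrite ltNge -d0 dJC dJ_ub1.
- have := lorentz_dist_ray_gt0 cM Mu s1.
  by rewrite ltNge -d0 dJ_ub1.
Qed.

Lemma lorentz_dist_triangle M S1 S2 S3 u v : timelike v0 ->
  conical_spacetime v0 M ->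
  Cauchy_hypersurface v0 M S1 -> Cauchy_hypersurface v0 M S2 ->
  Cauchy_hypersurface v0 M S3 -> compact S2 -> S1 u -> S3 v ->
  (lorentz_dist v0 M u v <= dJ v0 M S1 S2 + dJ v0 M S2 S3)%E.
Proof.
move=> tv0 cM C1 C2 C3 cS2 Su Sv.
have d12 := dJ_ge0 cM C1 C2; have d23 := dJ_ge0 cM C2 C3.
have Mu := C1.1 _ Su; have Mv := C3.1 _ Sv.
apply: lorentz_dist_le; first exact: adde_ge0.
move=> a b gamma fg; have len := lorentz_dist_ub fg.
have toS12 (x : \bar R) : (x <= dJ v0 M S1 S2 -> x <= dJ v0 M S1 S2 + dJ v0 M S2 S3)%E.
  by move=> /le_trans; apply; rewrite leeDl.
have toS23 (x : \bar R) : (x <= dJ v0 M S2 S3 -> x <= dJ v0 M S1 S2 + dJ v0 M S2 S3)%E.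
  by move=> /le_trans; apply; rewrite leeDr.
have vS2 : S2 v -> (curve_length a b gamma <= dJ v0 M S1 S2 + dJ v0 M S2 S3)%E.
  by move=> S2v; apply/toS12/(le_trans len)/dJ_ub1.
have uS2 : S2 u -> (curve_length a b gamma <= dJ v0 M S1 S2 + dJ v0 M S2 S3)%E.
  by move=> S2u; apply/toS23/(le_trans len)/dJ_ub1.
have [r [r0 Sr] _] := Cauchy_ray cM C2 Mv.
have [r1|r1|r1] := ltgtP r 1; last by apply: vS2; rewrite r1 scale1r in Sr.
- have [s [s0 Ss] _] := Cauchy_ray cM C2 Mu.
  have [s1|s1|s1] := ltgtP s 1; last by apply: uS2; rewrite s1 scale1r in Ss.
  (* [S2] lies below [u]: a ray segment over [[a - 1, a]] is put in front of the curve, which then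
     runs from [S2] to [S3]. *)
  + have [su fsu] := cone_future cM (C2.1 _ Ss).
    have is1 : 1 < s^-1 by rewrite invf_gt1.
    have [fs _] := ray_segment_curve (a - 1) (cone_scale cM) (C2.1 _ Ss) is1 su fsu.
    rewrite scalerA mulVf ?gt_eqF// scale1r subrK in fs.
    have [eta feta leta] := future_causal_concat fs fg.
    apply/toS23/(le_trans _ (dJ_ub1 M Ss Sv))/(le_trans _ (lorentz_dist_ub feta)).
    by rewrite leta leeDr// curve_length_ge0.
  + have [t /andP[at_ tb] St] := Cauchy_crossing tv0 cM C2 cS2 fg (ltW s1) Ss r0 (ltW r1) Sr.
    have [fg' ga gb] := fg.
    (* A curve needs an interval with interior points, so a crossing at an endpoint is treated
       separately: then [u] or [v] itself lies in [S2]. *)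
    move: at_; rewrite le_eqVlt => /orP[/eqP ta|at_]; first by apply: uS2; rewrite -ga ta.
    move: tb; rewrite le_eqVlt => /orP[/eqP ta|tb]; first by apply: vS2; rewrite -gb -ta.
    rewrite (curve_length_split fg' (ltW at_) (ltW tb)); apply: leeD.
      apply: le_trans (dJ_ub1 M Su St); apply: lorentz_dist_ub.
      by split=> //; apply: future_curve_sub fg' _ _ _ => //; exact: ltW.
    apply: le_trans (dJ_ub1 M St Sv); apply: lorentz_dist_ub.
    by split=> //; apply: future_curve_sub fg' _ _ _ => //; exact: ltW.
(* [S2] lies above [v]: the curve is continued along the ray of [v], and then runs from [S1] to
   [S2]. *)
- have [tv fv] := cone_future cM Mv.
  have [fs _] := ray_segment_curve b (cone_scale cM) Mv r1 tv fv.
  have [eta feta leta] := future_causal_concat fg fs.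
  apply/toS12/(le_trans _ (dJ_ub1 M Su Sr))/(le_trans _ (lorentz_dist_ub feta)).
  by rewrite leta leeDl// curve_length_ge0.
Qed.

Lemma dJ_triangle M S1 S2 S3 : timelike v0 -> conical_spacetime v0 M ->
  Cauchy_hypersurface v0 M S1 -> Cauchy_hypersurface v0 M S2 ->
  Cauchy_hypersurface v0 M S3 -> compact S2 ->
  (dJ v0 M S1 S3 <= dJ v0 M S1 S2 + dJ v0 M S2 S3)%E.
Proof.
move=> tv0 cM C1 C2 C3 cS2; apply: dJ_le => u v Su Sv.
have [->|->] := lorentz_dist_asym M u v tv0; rewrite ?add0e ?adde0.
  (* For the distance from [v] to [u] the roles of [S1] and [S3] are exchanged. *)
  rewrite addeC (dJC M S1) (dJC M S2).
  exact: lorentz_dist_triangle.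
exact: lorentz_dist_triangle.
Qed.

End CauchyMetric.

(** * Finiteness and the metric axioms for real values *)

Unset Implicit Arguments.

Theorem proposition1p5 (R : realType) (n : nat) (v0 : 'rV[R]_n.+1)
    (v0_timelike : timelike v0) (M : set 'rV[R]_n.+1)
    (M_conical : conical_spacetime v0 M)
    (M_spatially_compact : spatially_compact v0 M) :
  (forall S1 S2 : set 'rV[R]_n.+1,
     Cauchy_hypersurface v0 M S1 -> Cauchy_hypersurface v0 M S2 ->
     (0 <= dJ v0 M S1 S2)%E /\ (dJ v0 M S1 S2 < +oo)%E) /\
  is_metric_on (Cauchy_hypersurface v0 M)
    (fun S1 S2 : set 'rV[R]_n.+1 => fine (dJ v0 M S1 S2)).
Proof.
have cpt := M_spatially_compact.2.
have finite S1 S2 : Cauchy_hypersurface v0 M S1 -> Cauchy_hypersurface v0 M S2 ->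
    (0 <= dJ v0 M S1 S2)%E /\ (dJ v0 M S1 S2 < +oo)%E.
  by move=> C1 C2; split; [exact: dJ_ge0|apply: dJ_lty => //; exact: cpt].
have fin S1 S2 : Cauchy_hypersurface v0 M S1 -> Cauchy_hypersurface v0 M S2 ->
    dJ v0 M S1 S2 \is a fin_num.
  by move=> C1 C2; have [? ?] := finite _ _ C1 C2; rewrite ge0_fin_numE.
split; first exact: finite.
split.
- by move=> S1 S2 C1 C2; apply: fine_ge0; exact: dJ_ge0.
- move=> S1 S2 C1 C2; split=> [/eqP|->]; last by rewrite dJ_self.
  rewrite fine_eq0 ?fin// => /eqP d0; apply/seteqP; split.
    exact: dJ_eq0_subset d0.
  by rewrite dJC in d0; exact: dJ_eq0_subset d0.
- by move=> S1 S2 _ _; rewrite dJC.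
- move=> S1 S2 S3 C1 C2 C3; rewrite -fineD ?fin// fine_le ?fin ?fin_numD ?fin//.
  by apply: dJ_triangle => //; exact: cpt.
Qed.
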